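(* Let $\mathcal{A}$ be a quasi-abelian category equipped with a rank function and a $\Lambda$-valued slope function $\mu$, where $\Lambda$ is a totally ordered, uniquely divisible abelian group. Then: (0) Any morphism in $W\mathcal{A}$ is strictly compatible and strictly co-compatible with the filtrations. (1) The category $W\mathcal{A}$ is abelian. (2) The full subcategory inclusion $W\mathcal{A} \hookrightarrow \mathrm{Fun}(\Lambda,\mathcal{A})$ is strongly exact. In other words, the functor $W_{\leq\lambda}: W\mathcal{A} \to \mathcal{A}$, $(M,W) \mapsto W_{\leq\lambda}M$, is strongly exact for every $\lambda \in \Lambda$. Also the functor $\mathrm{gr}^W_\lambda: W\mathcal{A} \to \mathcal{A}$ is strongly exact for every $\lambda \in \Lambda$.
   Context: All categories are essentially small. In an additive category with kernels and cokernels, put $\mathrm{Coim} f = \mathrm{Coker}(\ker f)$ and $\mathrm{Im} f = \mathrm{Ker}(\mathrm{coker} f)$; $f$ is strict if the canonical morphism $\mathrm{Coim} f \to \mathrm{Im} f$ is an isomorphism. Strict monics are exactly the kernels, strict epis exactly the cokernels. A sequence $0 \to M \xrightarrow{f} N \xrightarrow{g} P \to 0$ is short exact if $f = \ker g$ and $g = \mathrm{coker} f$. A quasi-abelian category is an additive category with kernels and cokernels in which kernels are stable under pushout and cokernels are stable under pullback. A functor between additive categories with kernels and cokernels is strongly exact if it preserves all kernels and cokernels. For strict subobjects $A, B$ of $X$: $X/A$ is the cokernel of $A \hookrightarrow X$, $A \cap B$ is the pullback, $A + B$ is the image of $A \oplus B \to X$. For $f: M \to N$ and strict subobjects $P \hookrightarrow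 M$, $Q \hookrightarrow N$: $f(P) = \mathrm{Im}(P \hookrightarrow M \to N)$ and $f^{-1}(Q)$ is the pullback of $Q \hookrightarrow N$ along $f$. Slope functions. A rank function $\mathrm{rk}$ assigns to each isomorphism class of $\mathcal{A}$ a natural number, is additive along short exact sequences, and is nonzero on nonzero objects. A degree function $\deg$ assigns to each isomorphism class an element of $\Lambda$ and is additive along short exact sequences. $\mu = \deg/\mathrm{rk}$ (defined on nonzero objects) is a slope function if for every epi-monic $\varphi: M \to N$ in $\mathcal{A}$ one has $\mu(M) \leq \mu(N)$, with equality if and only if $\varphi$ is an isomorphism. A nonzero object $M$ is semistable if $\mu(N) \leq \mu(M)$ for all nonzero subobjects $N \to M$. $\mathcal{A}(\lambda) \subset \mathcal{A}$ denotes the full subcategory consisting of zero and the semistable objects of slope $\lambda$. Filtrations. $\mathrm{Fun}(\Lambda,\mathcal{A})$ is the category of functors from the totally ordered set $\Lambda$ to $\mathcal{A}$. $W\mathcal{A}^{\mathrm{pre}} \subset \mathrm{Fun}(\Lambda,\mathcal{A})$ is the full subcategory of finite ascending filtrations: functors $\lambda \mapsto W_{\leq\lambda}M$ with colimit $M$ such that each $W_{\leq\lambda}M \to M$ is a strict monic and there are finitely many breaks $\lambda_0 < \dots < \lambda_r$ such that $W_{\leq\lambda}M = 0$ for $\lambda < \lambda_0$, $W_{\leq\lambda}M = W_{\leq\lambda_{i-1}}M$ for $\lambda_{i-1} \leq \lambda < \lambda_i$, and $W_{\leq\lambda}M = M$ for $\lambda \geq \lambda_r$ (no breaks if $M=0$).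 Objects are written $(M,W)$. Put $W_{<\lambda}M = \mathrm{colim}_{\lambda'<\lambda} W_{\leq\lambda'}M$ and $\mathrm{gr}^W_\lambda M = \mathrm{Coker}(W_{<\lambda}M \hookrightarrow W_{\leq\lambda}M)$. $W\mathcal{A} \subset W\mathcal{A}^{\mathrm{pre}}$ is the full subcategory of $(M,W)$ with $\mathrm{gr}^W_\lambda M \in \mathcal{A}(\lambda)$ for all $\lambda \in \Lambda$. A morphism $f: M \to N$ in $W\mathcal{A}^{\mathrm{pre}}$ (with underlying morphism $f: M \to N$ in $\mathcal{A}$ on colimits) is strictly compatible with the filtrations if $f(W_{\leq\lambda}M) \hookrightarrow f(M) \cap W_{\leq\lambda}N$ is an isomorphism for all $\lambda$. It is strictly co-compatible with the filtrations if $(W_{\leq\lambda}M + \mathrm{Ker}_{\mathcal{A}} f)/\mathrm{Ker}_{\mathcal{A}} f \to f^{-1}(W_{\leq\lambda}N)/\mathrm{Ker}_{\mathcal{A}} f$ is an isomorphism for all $\lambda$. *)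

(* Defs.v *)
From HB Require Import structures.
From mathcomp Require Import all_boot all_order all_algebra.
From mathcomp Require Import boolp classical_sets.

Set Implicit Arguments.
Unset Strict Implicit.
Unset Printing Implicit Defensive.

Import Order.TTheory GRing.Theory Num.Theory.
Local Open Scope ring_scope.

Declare Scope cat_scope.
Delimit Scope cat_scope with cat.

#[local] Obligation Tactic := idtac.

Record preadditive := Preadditive {
  ob :> Type;
  Mor : ob -> ob -> zmodType;
  idm : forall X, Mor X X;
  mcomp : forall X Y Z, Mor Y Z -> Mor X Y -> Mor X Z;
  mcompA : forall X Y Z T (h : Mor Z T) (g : Mor Y Z) (f : Mor X Y),
    mcomp h (mcomp g f) = mcomp (mcomp h g) f;
  mcomp1m : forall X Y (f : Mor X Y), mcomp (idm Y) f = f;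
  mcompm1 : forall X Y (f : Mor X Y), mcomp f (idm X) = f;
  mcompDl : forall X Y Z (g g' : Mor Y Z) (f : Mor X Y),
    mcomp (g + g') f = mcomp g f + mcomp g' f;
  mcompDr : forall X Y Z (g : Mor Y Z) (f f' : Mor X Y),
    mcomp g (f + f') = mcomp g f + mcomp g f'
}.

Arguments Mor {p} X Y.
Arguments idm {p} X.
Arguments mcomp {p X Y Z} g f.

Notation "g ∘ f" := (mcomp g f) (at level 40, left associativity) : cat_scope.
Local Open Scope cat_scope.

Section Preadditive.
Variable C : preadditive.
Implicit Types X Y Z : C.

Definition is_iso X Y (f : Mor X Y) : Prop :=
  exists g : Mor Y X, g ∘ f = idm X /\ f ∘ g = idm Y.

Definition isomorphic X Y : Prop := exists f : Mor X Y, is_iso f.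

Definition is_monic X Y (f : Mor X Y) : Prop :=
  forall Z (g h : Mor Z X), f ∘ g = f ∘ h -> g = h.

Definition is_epi X Y (f : Mor X Y) : Prop :=
  forall Z (g h : Mor Y Z), g ∘ f = h ∘ f -> g = h.

Definition is_zero X : Prop :=
  forall Y (f : Mor X Y) (g : Mor Y X), f = 0 /\ g = 0.

Definition is_biproduct X Y S (i1 : Mor X S) (i2 : Mor Y S)
    (p1 : Mor S X) (p2 : Mor S Y) : Prop :=
  [/\ p1 ∘ i1 = idm X, p2 ∘ i2 = idm Y, p1 ∘ i2 = 0, p2 ∘ i1 = 0
    & i1 ∘ p1 + i2 ∘ p2 = idm S].

Definition is_additive : Prop :=
  (exists Z : C, is_zero Z) /\
  (forall X Y, exists S (i1 : Mor X S) (i2 : Mor Y S) (p1 : Mor S X)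
     (p2 : Mor S Y), is_biproduct i1 i2 p1 p2).

Definition is_kernel X Y (f : Mor X Y) K (k : Mor K X) : Prop :=
  f ∘ k = 0 /\
  forall T (t : Mor T X), f ∘ t = 0 -> exists! u : Mor T K, k ∘ u = t.

Definition is_cokernel X Y (f : Mor X Y) Q (q : Mor Y Q) : Prop :=
  q ∘ f = 0 /\
  forall T (t : Mor Y T), t ∘ f = 0 -> exists! u : Mor Q T, u ∘ q = t.

Definition has_kernels : Prop :=
  forall X Y (f : Mor X Y), exists K (k : Mor K X), is_kernel f k.

Definition has_cokernels : Prop :=
  forall X Y (f : Mor X Y), exists Q (q : Mor Y Q), is_cokernel f q.

Definition is_image X Y (f : Mor X Y) I (i : Mor I Y) : Prop :=
  exists Q (q : Mor Y Q), is_cokernel f q /\ is_kernel q i.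

Definition is_coimage X Y (f : Mor X Y) J (j : Mor X J) : Prop :=
  exists K (k : Mor K X), is_kernel f k /\ is_cokernel k j.

(* [u] is the canonical morphism Coim f -> Im f: as [j] is epi and [i] is
   monic, it is the only morphism with [i ∘ u ∘ j = f]. *)
Definition is_strict X Y (f : Mor X Y) : Prop :=
  exists J (j : Mor X J) I (i : Mor I Y) (u : Mor J I),
    [/\ is_coimage f j, is_image f i, i ∘ u ∘ j = f & is_iso u].

Definition is_strict_monic X Y (f : Mor X Y) : Prop :=
  is_monic f /\ is_strict f.

Definition is_pullback X Y Z (f : Mor X Z) (g : Mor Y Z)
    P (p : Mor P X) (q : Mor P Y) : Prop :=
  f ∘ p = g ∘ q /\
  forall T (a : Mor T X) (b : Mor T Y), f ∘ a = g ∘ b ->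
    exists! u : Mor T P, p ∘ u = a /\ q ∘ u = b.

Definition is_pushout X Y Z (f : Mor Z X) (g : Mor Z Y)
    P (p : Mor X P) (q : Mor Y P) : Prop :=
  p ∘ f = q ∘ g /\
  forall T (a : Mor X T) (b : Mor Y T), a ∘ f = b ∘ g ->
    exists! u : Mor P T, u ∘ p = a /\ u ∘ q = b.

Definition is_quasi_abelian : Prop :=
  [/\ is_additive, has_kernels, has_cokernels,
      forall X Y Z (i : Mor Z X) (g : Mor Z Y) P (p : Mor X P) (i' : Mor Y P),
        is_pushout i g p i' ->
        (exists W (f : Mor X W), is_kernel f i) ->
        exists W (f : Mor P W), is_kernel f i'
    & forall X Y Z (e : Mor X Z) (g : Mor Y Z) P (p : Mor P X) (e' : Mor P Y),
        is_pullback e g p e' ->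
        (exists W (f : Mor W X), is_cokernel f e) ->
        exists W (f : Mor W P), is_cokernel f e'].

Definition is_abelian : Prop :=
  [/\ is_additive, has_kernels, has_cokernels
    & forall X Y (f : Mor X Y), is_strict f].

Definition short_exact X Y Z (f : Mor X Y) (g : Mor Y Z) : Prop :=
  is_kernel g f /\ is_cokernel f g.

(* [c : A ∩ B -> X] for the subobjects [a : A -> X] and [b : B -> X]. *)
Definition is_intersection X A B (a : Mor A X) (b : Mor B X)
    P (c : Mor P X) : Prop :=
  exists (p : Mor P A) (q : Mor P B), is_pullback a b p q /\ c = a ∘ p.

(* [s : A + B -> X], the image of [(a, b) : A ⊕ B -> X]. *)
Definition is_sum X A B (a : Mor A X) (b : Mor B X) S (s : Mor S X) : Prop :=
  exists D (i1 : Mor A D) (i2 : Mor B D) (p1 : Mor D A) (p2 : Mor D B),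
    is_biproduct i1 i2 p1 p2 /\ is_image (a ∘ p1 + b ∘ p2) s.

(* [r : f^-1(B) -> X] for [f : X -> Y] and the subobject [b : B -> Y]. *)
Definition is_preimage X Y (f : Mor X Y) B (b : Mor B Y)
    R (r : Mor R X) : Prop :=
  exists q : Mor R B, is_pullback f b r q.

Lemma is_isoM X Y Z (g : Mor Y Z) (f : Mor X Y) :
  is_iso g -> is_iso f -> is_iso (g ∘ f).
Proof.
move=> [g' [g1 g2]] [f' [f1 f2]]; exists (f' ∘ g'); split.
  by rewrite mcompA -(mcompA f' g' g) g1 mcompm1.
by rewrite mcompA -(mcompA g f f') f2 mcompm1.
Qed.

Lemma is_iso_cancel X Y Z (g : Mor Y Z) (f : Mor X Y) :
  is_iso g -> is_iso (g ∘ f) -> is_iso f.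
Proof.
move=> [g' [g1 g2]] isogf.
have -> : f = g' ∘ (g ∘ f) by rewrite mcompA g1 mcomp1m.
by apply: is_isoM => //; exists g.
Qed.

End Preadditive.

Arguments is_zero {C} X.

Section Zero.
Variable C : preadditive.

Lemma mcomp0m (X Y Z : C) (f : Mor X Y) : (0 : Mor Y Z) ∘ f = 0.
Proof. by apply: (@addrI _ (0 ∘ f)); rewrite -mcompDl !addr0. Qed.

Lemma mcompm0 (X Y Z : C) (g : Mor Y Z) : g ∘ (0 : Mor X Y) = 0.
Proof. by apply: (@addrI _ (g ∘ 0)); rewrite -mcompDr !addr0. Qed.

Lemma mcompNm (X Y Z : C) (g : Mor Y Z) (f : Mor X Y) : (- g) ∘ f = - (g ∘ f).
Proof. by apply: (@addrI _ (g ∘ f)); rewrite -mcompDl !subrr mcomp0m. Qed.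

Lemma mcompmN (X Y Z : C) (g : Mor Y Z) (f : Mor X Y) : g ∘ (- f) = - (g ∘ f).
Proof. by apply: (@addrI _ (g ∘ f)); rewrite -mcompDr !subrr mcompm0. Qed.

Lemma is_zero_id (X : C) : idm X = 0 -> is_zero X.
Proof.
by move=> X0 Y f g; rewrite -(mcompm1 f) -(mcomp1m g) X0 mcompm0 mcomp0m.
Qed.

End Zero.

Record functor (C D : preadditive) := Functor {
  fob :> C -> D;
  fmap : forall X Y : C, Mor X Y -> Mor (fob X) (fob Y);
  fmap1 : forall X : C, fmap (idm X) = idm (fob X);
  fmapM : forall (X Y Z : C) (g : Mor Y Z) (f : Mor X Y),
    fmap (g ∘ f) = fmap g ∘ fmap f
}.

Arguments fmap {C D} _ {X Y} _.

Program Definition fcomp (C D E : preadditive) (G : functor D E)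
    (F : functor C D) : functor C E :=
  @Functor C E (fun X => G (F X)) (fun X Y f => fmap G (fmap F f)) _ _.
Next Obligation. by move=> * /=; rewrite !fmap1. Qed.
Next Obligation. by move=> * /=; rewrite !fmapM. Qed.

Definition strongly_exact (C D : preadditive) (F : functor C D) : Prop :=
  (forall (X Y K : C) (f : Mor X Y) (k : Mor K X),
     is_kernel f k -> is_kernel (fmap F f) (fmap F k)) /\
  (forall (X Y Q : C) (f : Mor X Y) (q : Mor Y Q),
     is_cokernel f q -> is_cokernel (fmap F f) (fmap F q)).

Section FullSubcategory.
Variables (C : preadditive) (P : C -> Prop).

Program Definition full_sub : preadditive :=
  @Preadditive {X : C | P X} (fun X Y => Mor (sval X) (sval Y))
    (fun X => idm (sval X)) (fun X Y Z g f => g ∘ f) _ _ _ _ _.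
Next Obligation. by move=> *; exact: mcompA. Qed.
Next Obligation. by move=> *; exact: mcomp1m. Qed.
Next Obligation. by move=> *; exact: mcompm1. Qed.
Next Obligation. by move=> *; exact: mcompDl. Qed.
Next Obligation. by move=> *; exact: mcompDr. Qed.

Program Definition full_incl : functor full_sub C :=
  @Functor full_sub C (fun X => sval X) (fun X Y f => f) _ _.
Next Obligation. by []. Qed.
Next Obligation. by []. Qed.

End FullSubcategory.

Section Diagrams.
Variables (d : Order.disp_t) (L : porderType d) (A : preadditive).
Local Open Scope order_scope.

(* Functors from the poset [L], seen as a category, to [A]. *)
Record diagram := Diagram {
  dob :> L -> A;
  dmap : forall l m : L, l <= m -> Mor (dob l) (dob m);
  dmap1 : forall (l : L) (h : l <= l), dmap h = idm (dob l);
  dmapM : forall (l m n : L) (hlm : l <= m) (hmn : m <= n) (hln : l <= n),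
    dmap hmn ∘ dmap hlm = dmap hln
}.

Record nat_trans (F G : diagram) := NatTrans {
  nt :> forall l : L, Mor (F l) (G l);
  ntP : forall (l m : L) (h : l <= m), nt m ∘ dmap F h = dmap G h ∘ nt l
}.

End Diagrams.

Arguments dmap {d L A} _ {l m} _.

Section FunctorCategory.
Variables (d : Order.disp_t) (L : porderType d) (A : preadditive).

Section NatTransZmod.
Variables F G : diagram L A.

Lemma nat_trans_eq (s t : nat_trans F G) : (forall l, s l = t l) -> s = t.
Proof.
case: s t => [s sP] [t tP] /= st.
have {st} est : s = t by exact: functional_extensionality_dep.
by case: t / est tP => tP; congr NatTrans; exact: Prop_irrelevance.
Qed.

HB.instance Definition _ := gen_eqMixin (nat_trans F G).
HB.instance Definition _ := gen_choiceMixin (nat_trans F G).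

Program Definition nt_zero : nat_trans F G := @NatTrans _ _ _ F G (fun=> 0) _.
Next Obligation. by move=> *; rewrite mcomp0m mcompm0. Qed.

Program Definition nt_opp (s : nat_trans F G) : nat_trans F G :=
  @NatTrans _ _ _ F G (fun l => - s l) _.
Next Obligation. by move=> s l m h; rewrite mcompNm mcompmN ntP. Qed.

Program Definition nt_add (s t : nat_trans F G) : nat_trans F G :=
  @NatTrans _ _ _ F G (fun l => s l + t l) _.
Next Obligation. by move=> s t l m h; rewrite mcompDl mcompDr !ntP. Qed.

Fact nt_addA : associative nt_add.
Proof. by move=> s t u; apply: nat_trans_eq => l; rewrite /= addrA. Qed.
Fact nt_addC : commutative nt_add.
Proof. by move=> s t; apply: nat_trans_eq => l; rewrite /= addrC. Qed.
Fact nt_add0 : left_id nt_zero nt_add.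
Proof. by move=> s; apply: nat_trans_eq => l; rewrite /= add0r. Qed.
Fact nt_addN : left_inverse nt_zero nt_opp nt_add.
Proof. by move=> s; apply: nat_trans_eq => l; rewrite /= addNr. Qed.

HB.instance Definition _ :=
  GRing.isZmodule.Build (nat_trans F G) nt_addA nt_addC nt_add0 nt_addN.

End NatTransZmod.

Program Definition nt_id (F : diagram L A) : nat_trans F F :=
  @NatTrans _ _ _ F F (fun l => idm (F l)) _.
Next Obligation. by move=> *; rewrite mcomp1m mcompm1. Qed.

Program Definition nt_comp (F G H : diagram L A) (t : nat_trans G H)
    (s : nat_trans F G) : nat_trans F H :=
  @NatTrans _ _ _ F H (fun l => t l ∘ s l) _.
Next Obligation. by move=> F G H t s l m h; rewrite -mcompA ntP !mcompA ntP. Qed.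

Program Definition fun_cat : preadditive :=
  @Preadditive (diagram L A) (fun F G => nat_trans F G) nt_id nt_comp _ _ _ _ _.
Next Obligation. by move=> *; apply: nat_trans_eq => l; exact: mcompA. Qed.
Next Obligation. by move=> *; apply: nat_trans_eq => l; exact: mcomp1m. Qed.
Next Obligation. by move=> *; apply: nat_trans_eq => l; exact: mcompm1. Qed.
Next Obligation. by move=> *; apply: nat_trans_eq => l; exact: mcompDl. Qed.
Next Obligation. by move=> *; apply: nat_trans_eq => l; exact: mcompDr. Qed.

Program Definition eval_at (l : L) : functor fun_cat A :=
  @Functor fun_cat A (fun F => F l) (fun F G s => s l) _ _.
Next Obligation. by []. Qed.
Next Obligation. by []. Qed.

(* Colimit of the restriction of [F] to the full subposet [P] of [L]. *)
Record colimit (P : pred L) (F : diagram L A) := Colimit {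
  colim :> A;
  colim_in : forall l, P l -> Mor (F l) colim;
  colim_cocone : forall l m (Pl : P l) (Pm : P m) (h : (l <= m)%O),
    colim_in Pm ∘ dmap F h = colim_in Pl;
  colim_univ : forall (T : A) (t : forall l, P l -> Mor (F l) T),
    (forall l m (Pl : P l) (Pm : P m) (h : (l <= m)%O),
       t m Pm ∘ dmap F h = t l Pl) ->
    exists! u : Mor colim T, forall l (Pl : P l), u ∘ colim_in Pl = t l Pl
}.

Arguments colim_in {P F} _ {l} _.

Section ColimMap.
Variables (P : pred L) (F G : diagram L A).
Variables (X : colimit P F) (Y : colimit P G) (s : nat_trans F G).

Fact colim_map_subproof :
  exists u : Mor X Y, forall l (Pl : P l),
    u ∘ colim_in X Pl = colim_in Y Pl ∘ s l.
Proof.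
have [|u [uP _]] :=
  @colim_univ P F X Y (fun l (Pl : P l) => colim_in Y Pl ∘ s l); last by exists u.
by move=> l m Pl Pm h; rewrite -mcompA ntP mcompA colim_cocone.
Qed.

Definition colim_map : Mor X Y := sval (cid colim_map_subproof).

Lemma colim_mapE l (Pl : P l) :
  colim_map ∘ colim_in X Pl = colim_in Y Pl ∘ s l.
Proof. by rewrite /colim_map; case: cid. Qed.

End ColimMap.

Lemma colim_ext (P : pred L) (F : diagram L A) (X : colimit P F) (T : A)
    (u v : Mor X T) :
  (forall l (Pl : P l), u ∘ colim_in X Pl = v ∘ colim_in X Pl) -> u = v.
Proof.
move=> uv.
have [|w [_ wP]] :=
  @colim_univ P F X T (fun l (Pl : P l) => v ∘ colim_in X Pl).
  by move=> l m Pl Pm h; rewrite -mcompA colim_cocone.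
by rewrite -(wP u) // -(wP v).
Qed.

Lemma colim_map1 (P : pred L) (F : diagram L A) (X : colimit P F) :
  colim_map X X (nt_id F) = idm X.
Proof. by apply: colim_ext => l Pl; rewrite colim_mapE mcompm1 mcomp1m. Qed.

Lemma colim_mapM (P : pred L) (F G H : diagram L A) (X : colimit P F)
    (Y : colimit P G) (Z : colimit P H) (t : nat_trans G H) (s : nat_trans F G) :
  colim_map X Z (nt_comp t s) = colim_map Y Z t ∘ colim_map X Y s.
Proof.
apply: colim_ext => l Pl.
by rewrite -mcompA !colim_mapE mcompA colim_mapE /= mcompA.
Qed.

End FunctorCategory.

Arguments colim_in {d L A P F} _ {l} _.

(* Totally ordered, uniquely divisible abelian groups. *)
Record divOrderedGroup := DivOrderedGroup {
  dog_zmod :> porderZmodType;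
  dog_total : total (<=%R : rel dog_zmod);
  dog_leD2l : forall z x y : dog_zmod, x <= y -> z + x <= z + y;
  dog_divisible : forall n : nat, (0 < n)%N ->
    forall x : dog_zmod, exists! y : dog_zmod, y *+ n = x
}.

(* The unique [y] with [y *+ n = x] when [0 < n]. *)
Definition dog_div (L : divOrderedGroup) (x : L) (n : nat) : L :=
  xget 0 (fun y : L => y *+ n = x).

Lemma dog_divK (L : divOrderedGroup) (x : L) (n : nat) :
  (0 < n)%N -> dog_div x n *+ n = x.
Proof.
move=> n_gt0; have [y [yx _]] := dog_divisible n_gt0 x.
exact: (xgetPex 0 (ex_intro (fun y : L => y *+ n = x) y yx)).
Qed.

Record quasiAbelianCat := QuasiAbelianCat {
  qa_cat :> preadditive;
  qa_quasi_abelian : is_quasi_abelian qa_cat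
}.

Lemma dog_le_or_lt (L : divOrderedGroup) (x y : L) : x <= y \/ y < x.
Proof. by case: (comparable_leP (dog_total x y)); [left|right]. Qed.

Section Filtrations.
Variables (L : divOrderedGroup) (A : quasiAbelianCat).

(* The sequence [s] of breaks is [λ_0 < ... < λ_r]; equality of subobjects of
   [M] means that the transition morphism between them is an isomorphism. *)
Definition has_breaks (W : diagram L A) (M : colimit predT W) (s : seq L) :
    Prop :=
  [/\ sorted <%R s,
      s = [::] <-> is_zero (colim M),
      (0 < size s)%N -> forall l, l < s`_0 -> is_zero (W l),
      forall i, (i.+1 < size s)%N -> forall l (h : s`_i <= l),
        l < s`_i.+1 -> is_iso (dmap W h)
    & (0 < size s)%N -> forall l, last 0 s <= l ->
        is_iso (colim_in M (isT : predT l))].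

Definition is_filtered_by (W : diagram L A) (M : colimit predT W) : Prop :=
  (forall l : L, is_strict_monic (colim_in M (isT : predT l))) /\
  exists s : seq L, has_breaks M s.

Definition is_filtration (W : fun_cat L A) : Prop :=
  exists M : colimit predT W, is_filtered_by M.

Definition WApre : preadditive := full_sub is_filtration.

Implicit Types X Y : WApre.

(* The underlying object [M] of a filtration [(M, W)], its colimit. *)
Definition total_ob X : colimit predT (sval X) := sval (cid (svalP X)).

Lemma totalP X : is_filtered_by (total_ob X).
Proof. by rewrite /total_ob; case: cid. Qed.

Definition W_in X (l : L) : Mor (sval X l) (total_ob X) :=
  colim_in (total_ob X) (isT : predT l).

Definition total_map X Y (f : Mor X Y) : Mor (total_ob X) (total_ob Y) :=
  colim_map (total_ob X) (total_ob Y) f.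

(* [W] restricted to [m < l] vanishes or is eventually constant, so that its
   colimit W_{<l} exists although [A] has only finite colimits. *)
Lemma eventually_iso_below X (l : L) :
  (forall m, m < l -> is_zero (sval X m)) \/
  exists2 b, b < l & forall m (h : b <= m), m < l -> is_iso (dmap (sval X) h).
Proof.
have [W_mono [s [_ s0 s1 s2 s3]]] := totalP X.
case Ej : (find (>= l) s) => [|i].
  left=> m ml; case: s s0 s1 {s2 s3} Ej => [|b s] s0 s1 /=.
    move=> _; apply: is_zero_id; apply: (W_mono m).1.
    have M0 : is_zero (total_ob X) by apply/s0.
    by rewrite (M0 _ 0 (_ ∘ idm _)).2 (M0 _ 0 (_ ∘ 0)).2.
  case: ifP => // lb _; apply: s1 => //=; exact: lt_le_trans lb.
have isz : (i < size s)%N by rewrite -ltnS -Ej ltnS find_size.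
right; exists s`_i.
  by rewrite (comparable_ltNge (dog_total _ _)); apply/negbT/(before_find 0); rewrite Ej.
move=> m h ml; have [Si|Si] := ltnP i.+1 (size s).
  apply: (s2 i) => //; apply: lt_le_trans ml _.
  by rewrite -Ej; apply: (nth_find 0); rewrite has_find Ej.
have Ei : s`_i = last 0 s.
  have sE : size s = i.+1 by apply/eqP; rewrite eqn_leq Si isz.
  by rewrite -nth_last sE.
have s_gt0 : (0 < size s)%N by exact: leq_ltn_trans isz.
apply: (@is_iso_cancel _ _ _ _ (colim_in (total_ob X) (isT : predT m))).
  by apply: s3 => //; rewrite -Ei.
by rewrite (@colim_cocone _ _ _ _ _ (total_ob X) s`_i m isT isT h); apply: s3 => //; rewrite Ei.
Qed.

Fact W_lt_subproof X (l : L) :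
  exists _ : colimit [pred m : L | m < l] (sval X), True.
Proof.
pose W := sval X; rewrite -/W.
have [W0|[b bl isoW]] := eventually_iso_below X l.
  have [[[Z Z0] _] _ _ _ _] := qa_quasi_abelian A.
  unshelve eexists (@Colimit _ _ _ [pred m | m < l] W Z (fun _ _ => 0) _ _) => //.
    by move=> m n Pm Pn h; rewrite mcomp0m.
  move=> T t tP; exists 0; split=> [m Pm|u _]; last by rewrite (Z0 _ u 0).1.
  by rewrite (W0 m Pm _ (t m Pm) 0).1 mcomp0m.
have ex m : m < l -> exists t : Mor (W m) (W b),
    (forall h : b <= m, t ∘ dmap W h = idm _) /\
    (forall h : m <= b, t = dmap W h).
  move=> ml; have [bm|mb] := dog_le_or_lt b m.
    have [t [t1 t2]] := isoW m bm ml; exists t; split=> h.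
      by rewrite (Prop_irrelevance h bm).
    by rewrite -[RHS]mcomp1m -t1 -mcompA (dmapM _ _ _ (lexx m)) dmap1 mcompm1.
  exists (dmap W (ltW mb)); split=> h; first by move: (le_lt_trans h mb); rewrite ltxx.
  by congr dmap; exact: Prop_irrelevance.
pose c m (Pm : [pred m | m < l] m) := sval (cid (ex m Pm)).
have cP m (Pm : [pred m | m < l] m) : (forall h : b <= m, c m Pm ∘ dmap W h = idm _) /\
    (forall h : m <= b, c m Pm = dmap W h) by rewrite /c; case: cid.
have c1 m Pm (h : b <= m) : dmap W h ∘ c m Pm = idm _.
  have [t [t1 t2]] := isoW m h Pm.
  by rewrite -[c m Pm]mcompm1 -t2 (mcompA (c m Pm)) (cP m Pm).1 mcomp1m.
unshelve eexists (@Colimit _ _ _ [pred m | m < l] W (W b) c _ _) => //.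
  move=> m n Pm Pn h; have [bm|mb] := dog_le_or_lt b m.
    have bn := le_trans bm h.
    rewrite -[LHS]mcompm1 -(c1 m Pm bm) -(mcompA (c n Pn)) (mcompA (dmap W h)) (dmapM _ _ _ bn).
    by rewrite mcompA (cP n Pn).1 mcomp1m.
  have [bn|nb] := dog_le_or_lt b n.
    by rewrite (cP m Pm).2 ?ltW// => hmb; rewrite -(dmapM _ hmb bn h) mcompA (cP n Pn).1 mcomp1m.
  by rewrite (cP m Pm).2 ?ltW// (cP n Pn).2 ?ltW// => h1 h2; rewrite (dmapM _ _ _ h2).
move=> T t tP; exists (t b bl); split=> [m Pm|u uP].
  have [bm|mb] := dog_le_or_lt b m.
    by rewrite -(tP b m bl Pm bm) -mcompA c1 mcompm1.
  by rewrite (cP m Pm).2 ?ltW// => h; rewrite tP.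
by rewrite -(uP b bl) (cP b bl).2 // (dmap1 W) mcompm1.
Qed.

Definition W_lt X (l : L) : colimit [pred m : L | m < l] (sval X) :=
  sval (cid (W_lt_subproof X l)).

Fact W_lt_le_subproof X (l : L) : exists u : Mor (W_lt X l) (sval X l),
  forall m (ml : m < l), u ∘ colim_in (W_lt X l) ml = dmap (sval X) (ltW ml).
Proof.
have [|u [uP _]] := @colim_univ _ _ _ _ _ (W_lt X l) (sval X l)
  (fun m (ml : m < l) => dmap (sval X) (ltW ml)); last by exists u.
by move=> m n ml nl h; exact: dmapM.
Qed.

Definition W_lt_le X (l : L) : Mor (W_lt X l) (sval X l) :=
  sval (cid (W_lt_le_subproof X l)).

Lemma W_lt_leE X (l : L) m (ml : m < l) :
  W_lt_le X l ∘ colim_in (W_lt X l) ml = dmap (sval X) (ltW ml).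
Proof. by move: m ml; rewrite /W_lt_le; case: cid. Qed.

Fact gr_ob_subproof X (l : L) :
  exists Q : {Q : A & Mor (sval X l) Q}, is_cokernel (W_lt_le X l) (projT2 Q).
Proof.
have [_ _ cokA _ _] := qa_quasi_abelian A.
by have [Q [q qP]] := cokA _ _ (W_lt_le X l); exists (existT _ Q q).
Qed.

Definition gr_ob (l : L) X : A := projT1 (sval (cid (gr_ob_subproof X l))).

Definition gr_proj (l : L) X : Mor (sval X l) (gr_ob l X) :=
  projT2 (sval (cid (gr_ob_subproof X l))).

Lemma gr_projP (l : L) X : is_cokernel (W_lt_le X l) (gr_proj l X).
Proof. by rewrite /gr_proj /gr_ob; case: cid. Qed.

Lemma gr_projI (l : L) X T (u v : Mor (gr_ob l X) T) :
  u ∘ gr_proj l X = v ∘ gr_proj l X -> u = v.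
Proof.
move=> uv; have [p0 pU] := gr_projP l X.
have [|w [_ wP]] := pU T (v ∘ gr_proj l X); first by rewrite -mcompA p0 mcompm0.
by rewrite -(wP u) // -(wP v).
Qed.

Fact gr_map_subproof (l : L) X Y (f : Mor X Y) :
  exists u : Mor (gr_ob l X) (gr_ob l Y),
    u ∘ gr_proj l X = gr_proj l Y ∘ (f : nat_trans _ _) l.
Proof.
have [_ pU] := gr_projP l X.
have [|u [uP _]] := pU _ (gr_proj l Y ∘ (f : nat_trans _ _) l); last by exists u.
have [p0 _] := gr_projP l Y.
have fW : (f : nat_trans _ _) l ∘ W_lt_le X l =
    W_lt_le Y l ∘ colim_map (W_lt X l) (W_lt Y l) f.
  apply: colim_ext => m ml.
  by rewrite -!mcompA colim_mapE W_lt_leE (mcompA (W_lt_le Y l)) W_lt_leE ntP.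
by rewrite -mcompA fW mcompA p0 mcomp0m.
Qed.

Definition gr_map (l : L) X Y (f : Mor X Y) : Mor (gr_ob l X) (gr_ob l Y) :=
  sval (cid (gr_map_subproof l f)).

Lemma gr_mapE (l : L) X Y (f : Mor X Y) :
  gr_map l f ∘ gr_proj l X = gr_proj l Y ∘ (f : nat_trans _ _) l.
Proof. by rewrite /gr_map; case: cid. Qed.

Program Definition gr (l : L) : functor WApre A :=
  @Functor WApre A (gr_ob l) (gr_map l) _ _.
Next Obligation. by move=> l X; apply: gr_projI; rewrite gr_mapE mcompm1 mcomp1m. Qed.
Next Obligation.
by move=> l X Y Z g f; apply: gr_projI; rewrite -mcompA !gr_mapE mcompA gr_mapE mcompA.
Qed.

(* [i : f(W_l M) -> N], [j : f(M) -> N], [p : f(M) ∩ W_l N -> N]; as [p] is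
   monic, [u] is the canonical comparison morphism. *)
Definition strictly_compatible X Y (f : Mor X Y) : Prop :=
  forall l : L, exists (I : A) (i : Mor I (total_ob Y)) (J : A)
    (j : Mor J (total_ob Y)) (P : A) (p : Mor P (total_ob Y)) (u : Mor I P),
  [/\ is_image (total_map f ∘ W_in X l) i,
      is_image (total_map f) j,
      is_intersection j (W_in Y l) p,
      p ∘ u = i
    & is_iso u].

(* [k : K -> M] is Ker f, [s : W_l M + K -> M], [r : f^-1(W_l N) -> M];
   [S' = (W_l M + K)/K], [R' = f^-1(W_l N)/K], and [w] is the morphism induced
   by the inclusion [v] over [M]. *)
Definition strictly_cocompatible X Y (f : Mor X Y) : Prop :=
  forall l : L, exists (K : A) (k : Mor K (total_ob X))
    (S : A) (s : Mor S (total_ob X)) (kS : Mor K S)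
    (R : A) (r : Mor R (total_ob X)) (kR : Mor K R)
    (v : Mor S R) (S' : A) (qS : Mor S S') (R' : A) (qR : Mor R R')
    (w : Mor S' R'),
  [/\ is_kernel (total_map f) k,
      is_sum (W_in X l) k s,
      is_preimage (total_map f) (W_in Y l) r,
      [/\ s ∘ kS = k, r ∘ kR = k & r ∘ v = s]
    & [/\ is_cokernel kS qS, is_cokernel kR qR, w ∘ qS = qR ∘ v & is_iso w]].

End Filtrations.

Section Slopes.
Variables (L : divOrderedGroup) (A : quasiAbelianCat).

Definition rank_function (rk : A -> nat) : Prop :=
  [/\ forall M N : A, isomorphic M N -> rk M = rk N,
      forall (M N P : A) (f : Mor M N) (g : Mor N P),
        short_exact f g -> rk N = (rk M + rk P)%N
    & forall M : A, ~ is_zero M -> rk M <> 0%N].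

Definition degree_function (deg : A -> L) : Prop :=
  (forall M N : A, isomorphic M N -> deg M = deg N) /\
  (forall (M N P : A) (f : Mor M N) (g : Mor N P),
     short_exact f g -> deg N = deg M + deg P).

Variables (rk : A -> nat) (deg : A -> L).

(* Only meaningful for nonzero [M]. *)
Definition slope (M : A) : L := dog_div (deg M) (rk M).

Definition slope_function : Prop :=
  forall (M N : A) (f : Mor M N), ~ is_zero M -> ~ is_zero N ->
    is_monic f -> is_epi f ->
    slope M <= slope N /\ (slope M = slope N <-> is_iso f).

Definition semistable (M : A) : Prop :=
  ~ is_zero M /\
  forall (N : A) (f : Mor N M), is_monic f -> ~ is_zero N -> slope N <= slope M.

Definition semistable_of_slope (l : L) (M : A) : Prop :=
  is_zero M \/ (semistable M /\ slope M = l).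

Definition slope_filtration (X : WApre L A) : Prop :=
  forall l : L, semistable_of_slope l (gr A l X).

Definition WA : preadditive := full_sub slope_filtration.

Definition WA_pre : functor WA (WApre L A) := full_incl slope_filtration.

Definition WA_incl : functor WA (fun_cat L A) :=
  fcomp (full_incl (@is_filtration L A)) WA_pre.

Definition WA_le (l : L) : functor WA A := fcomp (eval_at A l) WA_incl.

Definition WA_gr (l : L) : functor WA A := fcomp (gr A l) WA_pre.

End Slopes.

(* Main.v *)
Require Import Defs.
From mathcomp Require Import all_boot all_order all_algebra.
From mathcomp Require Import boolp.

(* The filtrations of WA ascend by slope, so strictness of a morphism f is proved
   level by level, by induction on the number of breaks below l, with a snake lemma
   for the rows W_{<l} -> W_l -> gr_l. A slope argument (any f factors as a strict
   epi, an epi-monic and a strict monic) shows that gr_l f, a morphism of A(l), is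
   strict with kernel and cokernel in A(l), and that there are no nonzero morphisms
   from A(l) to A(m) for m < l. The cokernel of W_{<l} f is an iterated extension of
   objects of slopes < l, so the connecting morphism from Ker (gr_l f) vanishes:
   W_l f is strict, and its kernel and cokernel are extensions of those of gr_l f
   by those of W_{<l} f.
   Diagrams are chased with generalized elements: as strict epis are stable under
   pullback, one may lift along them after passing to a strict epi cover. *)

Set Implicit Arguments.
Unset Strict Implicit.
Unset Printing Implicit Defensive.

Import Order.TTheory GRing.Theory Num.Theory.
Local Open Scope ring_scope.
Local Open Scope cat_scope.

(** The obstacle is that a morphism of short exact sequences with strict outer terms need not be
    strict. If the first row starts with 0 and the second ends with 0, the outer terms are zero,
    while the middle one is an arbitrary morphism [M'' -> N'] and is its own connecting morphism.
    Strictness of the outer terms lets an element killed by a cokernel be lifted, up to a cover.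
    Vanishing of the connecting morphism then gives short exact sequences of kernels and of
    cokernels together with strictness in the middle. Kernels and cokernels in [WA] are those of the
    functor category, taken level by level. A levelwise kernel is a filtration for formal reasons. A
    levelwise cokernel is one only if its transition morphisms are strict monics, and these are
    composed of the left-hand maps of the snake sequences of cokernels. The same injectivity, from
    the cokernel at a level to the cokernel on colimits, gives both compatibilities: what lies in
    [W_l N] and in the image of [M] already comes from [W_l M]. *)

Section Preadditive.
Variable C : preadditive.
Implicit Types X Y Z T : C.

(** Left transparent, so that kernels in [opp_cat C] convert to cokernels in [C] and most dual
    lemmas hold by conversion. *)
Definition opp_cat : preadditive.
Proof.
unshelve refine (@Preadditive C (fun X Y => Mor Y X) (fun X => idm X)
  (fun X Y Z g f => f ∘ g) _ _ _ _ _).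
- by move=> *; rewrite mcompA.
- by move=> *; rewrite mcompm1.
- by move=> *; rewrite mcomp1m.
- by move=> *; rewrite mcompDr.
- by move=> *; rewrite mcompDl.
Defined.

Definition strict_epi X Y (e : Mor X Y) : Prop :=
  exists W (f : Mor W X), is_cokernel f e.

Definition strict_mono X Y (m : Mor X Y) : Prop :=
  exists W (f : Mor Y W), is_kernel f m.

(** A self-dual form of [is_strict] that chooses no coimage, image or comparison morphism. The two
    agree in a quasi-abelian category by [strict_factor_strict] and [strict_strict_factor]. *)
Definition strict_factor X Y (f : Mor X Y) : Prop :=
  exists I (e : Mor X I) (m : Mor I Y),
    [/\ strict_epi e, strict_mono m & m ∘ e = f].

Lemma mcompBr X Y Z (g : Mor Y Z) (f h : Mor X Y) : g ∘ (f - h) = g ∘ f - g ∘ h.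
Proof. by rewrite mcompDr mcompmN. Qed.

Lemma mcompBl X Y Z (g h : Mor Y Z) (f : Mor X Y) : (g - h) ∘ f = g ∘ f - h ∘ f.
Proof. by rewrite mcompDl mcompNm. Qed.

Lemma is_monicP X Y (f : Mor X Y) :
  (forall Z (z : Mor Z X), f ∘ z = 0 -> z = 0) -> is_monic f.
Proof.
move=> f0 Z g h fgh; apply/eqP; rewrite -subr_eq0; apply/eqP/f0.
by rewrite mcompBr fgh subrr.
Qed.

Lemma monic0 X Y Z (f : Mor X Y) (z : Mor Z X) : is_monic f -> f ∘ z = 0 -> z = 0.
Proof. by move=> fm fz; apply: fm; rewrite fz mcompm0. Qed.

Lemma kernel_comp0 X Y K (f : Mor X Y) (k : Mor K X) : is_kernel f k -> f ∘ k = 0.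
Proof. by case. Qed.

Lemma kernel_lift X Y K (f : Mor X Y) (k : Mor K X) T (t : Mor T X) :
  is_kernel f k -> f ∘ t = 0 -> exists u, k ∘ u = t.
Proof. by case=> _ /(_ T t) H /H [u [uP _]]; exists u. Qed.

Lemma kernel_monic X Y K (f : Mor X Y) (k : Mor K X) : is_kernel f k -> is_monic k.
Proof.
move=> [f0 kU]; apply: is_monicP => Z z kz.
have [|u [_ uU]] := kU Z 0; first by rewrite mcompm0.
by rewrite -(uU z kz) -(uU 0) ?mcompm0.
Qed.

Lemma kernelP X Y K (f : Mor X Y) (k : Mor K X) :
  f ∘ k = 0 -> is_monic k ->
  (forall T (t : Mor T X), f ∘ t = 0 -> exists u, k ∘ u = t) -> is_kernel f k.
Proof.
move=> fk km kl; split=> // T t /kl[u uP]; exists u; split=> // v vP.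
by apply: km; rewrite uP vP.
Qed.

Lemma strict_mono_monic X Y (m : Mor X Y) : strict_mono m -> is_monic m.
Proof. by move=> [W [f /kernel_monic]]. Qed.

Lemma monic_comp X Y Z (g : Mor Y Z) (f : Mor X Y) :
  is_monic g -> is_monic f -> is_monic (g ∘ f).
Proof. by move=> gm fm T a b; rewrite -!mcompA => /gm/fm. Qed.

Lemma monic_cancel X Y Z (g : Mor Y Z) (f : Mor X Y) :
  is_monic (g ∘ f) -> is_monic f.
Proof. by move=> gfm T a b ab; apply: gfm; rewrite -!mcompA ab. Qed.

Lemma is_iso_id X : is_iso (idm X).
Proof. by exists (idm X); rewrite !mcomp1m. Qed.

Lemma iso_monic X Y (f : Mor X Y) : is_iso f -> is_monic f.
Proof.
move=> [g [gf _]] T a b /(congr1 (mcomp g)).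
by rewrite !mcompA gf !mcomp1m.
Qed.

Lemma kernel_monic_comp X Y Z K (f : Mor X Y) (k : Mor K X) (m : Mor Y Z) :
  is_monic m -> is_kernel f k -> is_kernel (m ∘ f) k.
Proof.
move=> mm fk; apply: kernelP (kernel_monic fk) _.
  by rewrite -mcompA (kernel_comp0 fk) mcompm0.
move=> T t; rewrite -mcompA => /(monic0 mm); exact: kernel_lift.
Qed.

Lemma kernel_of_monic_comp X Y Z K (f : Mor X Y) (k : Mor K X) (m : Mor Y Z) :
  is_monic m -> is_kernel (m ∘ f) k -> is_kernel f k.
Proof.
move=> mm fk; apply: kernelP (kernel_monic fk) _.
  by apply: (monic0 mm); rewrite mcompA (kernel_comp0 fk).
by move=> T t ft; apply: (kernel_lift fk); rewrite -mcompA ft mcompm0.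
Qed.

Lemma kernel_iso X Y K K' (f : Mor X Y) (k : Mor K X) (i : Mor K' K) :
  is_iso i -> is_kernel f k -> is_kernel f (k ∘ i).
Proof.
move=> ii fk; apply: kernelP.
- by rewrite mcompA (kernel_comp0 fk) mcomp0m.
- exact: monic_comp (kernel_monic fk) (iso_monic ii).
- move=> T t /(kernel_lift fk) [u <-]; have [j [_ ij]] := ii.
  by exists (j ∘ u); rewrite mcompA -(mcompA k) ij mcompm1.
Qed.

Lemma kernel_uniq X Y K K' (f : Mor X Y) (k : Mor K X) (k' : Mor K' X) :
  is_kernel f k -> is_kernel f k' -> exists2 i : Mor K' K, is_iso i & k ∘ i = k'.
Proof.
move=> fk fk'; have [i ki] := kernel_lift fk (kernel_comp0 fk').
have [j kj] := kernel_lift fk' (kernel_comp0 fk).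
exists i => //; exists j; split.
  by apply: (kernel_monic fk'); rewrite mcompA kj ki mcompm1.
by apply: (kernel_monic fk); rewrite mcompA ki kj mcompm1.
Qed.

Lemma strict_mono_iso X Y (f : Mor X Y) : is_iso f -> strict_mono f.
Proof.
move=> fi; exists Y, 0; apply: kernelP (iso_monic fi) _; first by rewrite mcomp0m.
by move=> T t _; have [g [_ fg]] := fi; exists (g ∘ t); rewrite mcompA fg mcomp1m.
Qed.

Lemma strict_mono_isor X Y Z (f : Mor Y Z) (i : Mor X Y) :
  is_iso i -> strict_mono f -> strict_mono (f ∘ i).
Proof. by move=> ii [W [g gf]]; exists W, g; exact: kernel_iso. Qed.

Lemma zero_mor X Y (f g : Mor X Y) : is_zero X -> f = g.
Proof. by move=> X0; rewrite (X0 _ f 0).1 (X0 _ g 0).1. Qed.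

Lemma mor_zero X Y (f g : Mor X Y) : is_zero Y -> f = g.
Proof. by move=> Y0; rewrite (Y0 _ 0 f).2 (Y0 _ 0 g).2. Qed.

Lemma monic_to_zero X Y (f : Mor X Y) : is_monic f -> is_zero Y -> is_zero X.
Proof. by move=> fm Y0; apply: is_zero_id; apply: fm; exact: mor_zero. Qed.

Lemma zero_iso X Y (f : Mor X Y) : is_zero X -> is_zero Y -> is_iso f.
Proof. by move=> X0 Y0; exists 0; split; exact: zero_mor. Qed.

Lemma iso_zero X Y (f : Mor X Y) : is_iso f -> is_zero X -> is_zero Y.
Proof. by move=> [g [_ fg]] X0; apply: is_zero_id; rewrite -fg (X0 _ f g).1 mcomp0m. Qed.

Lemma is_iso_inv X Y (f : Mor X Y) :
  is_iso f -> exists g, [/\ g ∘ f = idm X, f ∘ g = idm Y & is_iso g].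
Proof. by move=> [g [gf fg]]; exists g; split=> //; exists f. Qed.

Lemma is_iso_cancelr X Y Z (g : Mor Y Z) (f : Mor X Y) :
  is_iso f -> is_iso (g ∘ f) -> is_iso g.
Proof.
move=> /is_iso_inv[f' [f1 f2 f'i]] gfi.
by have -> : g = (g ∘ f) ∘ f' by [rewrite -mcompA f2 mcompm1]; exact: is_isoM.
Qed.

Lemma kernel_map_iso X Y K X' Y' K' (f : Mor X Y) (k : Mor K X) (f' : Mor X' Y')
    (k' : Mor K' X') (a : Mor X X') (b : Mor Y Y') (u : Mor K K') :
  is_kernel f k -> is_kernel f' k' -> b ∘ f = f' ∘ a -> k' ∘ u = a ∘ k ->
  is_iso a -> is_monic b -> is_iso u.
Proof.
move=> fk fk' bf ku /is_iso_inv[a' [a1 a2 _]] bm.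
have [|v kv] := kernel_lift (t := a' ∘ k') fk.
  apply: (monic0 bm); rewrite mcompA bf -mcompA (mcompA a) a2 mcomp1m.
  exact: kernel_comp0.
exists v; split.
  by apply: (kernel_monic fk); rewrite mcompA kv -mcompA ku mcompA a1 mcomp1m mcompm1.
by apply: (kernel_monic fk'); rewrite mcompA ku -mcompA kv mcompA a2 mcomp1m mcompm1.
Qed.

End Preadditive.

(** * Cokernels and epis, by duality *)

Section Dual.
Variable C : preadditive.
Implicit Types X Y Z T : C.

Lemma epi0 X Y Z (f : Mor X Y) (z : Mor Y Z) : is_epi f -> z ∘ f = 0 -> z = 0.
Proof. exact: (@monic0 (opp_cat C)). Qed.

Lemma cokernel_comp0 X Y Q (f : Mor X Y) (q : Mor Y Q) : is_cokernel f q -> q ∘ f = 0.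
Proof. by case. Qed.

Lemma cokernel_desc X Y Q (f : Mor X Y) (q : Mor Y Q) T (t : Mor Y T) :
  is_cokernel f q -> t ∘ f = 0 -> exists u, u ∘ q = t.
Proof. exact: (@kernel_lift (opp_cat C)). Qed.

Lemma cokernel_epi X Y Q (f : Mor X Y) (q : Mor Y Q) : is_cokernel f q -> is_epi q.
Proof. exact: (@kernel_monic (opp_cat C)). Qed.

Lemma cokernelP X Y Q (f : Mor X Y) (q : Mor Y Q) :
  q ∘ f = 0 -> is_epi q ->
  (forall T (t : Mor Y T), t ∘ f = 0 -> exists u, u ∘ q = t) -> is_cokernel f q.
Proof. exact: (@kernelP (opp_cat C)). Qed.

Lemma strict_epi_epi X Y (e : Mor X Y) : strict_epi e -> is_epi e.
Proof. exact: (@strict_mono_monic (opp_cat C)). Qed.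

Lemma epi_comp X Y Z (g : Mor Y Z) (f : Mor X Y) :
  is_epi g -> is_epi f -> is_epi (g ∘ f).
Proof. by move=> gm fm T a b; rewrite !mcompA => /fm/gm. Qed.

Lemma epi_cancel X Y Z (g : Mor Y Z) (f : Mor X Y) : is_epi (g ∘ f) -> is_epi g.
Proof. exact: (@monic_cancel (opp_cat C)). Qed.

(** Duality swaps the two equations of [is_iso], so this transfer is not a mere conversion. *)
Lemma opp_iso X Y (f : Mor X Y) : is_iso f -> is_iso (C := opp_cat C) (f : Mor (Y : opp_cat C) X).
Proof. by move=> [g [gf fg]]; exists g. Qed.

Lemma iso_opp X Y (f : Mor X Y) : is_iso (C := opp_cat C) (f : Mor (Y : opp_cat C) X) -> is_iso f.
Proof. by move=> [g [gf fg]]; exists g. Qed.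

Lemma iso_epi X Y (f : Mor X Y) : is_iso f -> is_epi f.
Proof. move=> /opp_iso; exact: (@iso_monic (opp_cat C)). Qed.

Lemma opp_zero X : is_zero X -> is_zero (X : opp_cat C).
Proof. by move=> X0 Y f g; have [] := X0 Y g f. Qed.

Lemma cokernel_epi_comp X Y Z Q (f : Mor X Y) (q : Mor Y Q) (e : Mor Z X) :
  is_epi e -> is_cokernel f q -> is_cokernel (f ∘ e) q.
Proof. exact: (@kernel_monic_comp (opp_cat C)). Qed.

Lemma cokernel_of_epi_comp X Y Z Q (f : Mor X Y) (q : Mor Y Q) (e : Mor Z X) :
  is_epi e -> is_cokernel (f ∘ e) q -> is_cokernel f q.
Proof. exact: (@kernel_of_monic_comp (opp_cat C)). Qed.

Lemma cokernel_iso X Y Q Q' (f : Mor X Y) (q : Mor Y Q) (i : Mor Q Q') :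
  is_iso i -> is_cokernel f q -> is_cokernel f (i ∘ q).
Proof. move=> /opp_iso; exact: (@kernel_iso (opp_cat C)). Qed.

Lemma cokernel_uniq X Y Q Q' (f : Mor X Y) (q : Mor Y Q) (q' : Mor Y Q') :
  is_cokernel f q -> is_cokernel f q' -> exists2 i : Mor Q Q', is_iso i & i ∘ q = q'.
Proof.
move=> qP q'P; have [i /iso_opp ii iq] := @kernel_uniq (opp_cat C) _ _ _ _ _ _ _ qP q'P.
by exists i.
Qed.

Lemma strict_epi_iso X Y (f : Mor X Y) : is_iso f -> strict_epi f.
Proof. move=> /opp_iso; exact: (@strict_mono_iso (opp_cat C)). Qed.

Lemma strict_epi_isol X Y Z (f : Mor X Y) (i : Mor Y Z) :
  is_iso i -> strict_epi f -> strict_epi (i ∘ f).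
Proof. move=> /opp_iso; exact: (@strict_mono_isor (opp_cat C)). Qed.

Lemma epi_from_zero X Y (f : Mor X Y) : is_epi f -> is_zero X -> is_zero Y.
Proof. by move=> fe X0; apply: is_zero_id; apply: fe; exact: zero_mor. Qed.

Lemma cokernel_map_iso X Y Q X' Y' Q' (f : Mor X Y) (q : Mor Y Q) (f' : Mor X' Y')
    (q' : Mor Y' Q') (a : Mor X X') (b : Mor Y Y') (u : Mor Q Q') :
  is_cokernel f q -> is_cokernel f' q' -> b ∘ f = f' ∘ a -> u ∘ q = q' ∘ b ->
  is_iso b -> is_epi a -> is_iso u.
Proof.
move=> fq fq' bf uq /opp_iso bi ae.
apply: iso_opp; apply: (@kernel_map_iso (opp_cat C) _ _ _ _ _ _ _ _ _ _ _ _ _ fq' fq) bi ae => //.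
Qed.

Lemma strict_factor_opp X Y (f : Mor X Y) :
  strict_factor f -> strict_factor (C := opp_cat C) (f : Mor (Y : opp_cat C) X).
Proof. by move=> [I [e [m [es ms me]]]]; exists I, m, e. Qed.

Lemma short_exact_opp X Y Z (f : Mor X Y) (g : Mor Y Z) :
  short_exact f g -> short_exact (C := opp_cat C) (g : Mor (Z : opp_cat C) Y) f.
Proof. by case=> fk gc; split. Qed.

End Dual.

(** * Quasi-abelian categories and the snake lemma *)
Section QuasiAbelian.
Variable C : preadditive.
Hypothesis qC : is_quasi_abelian C.
Implicit Types X Y Z T : C.

Lemma opp_quasi_abelian : is_quasi_abelian (opp_cat C).
Proof.
have [[[Z Z0] bip] hk hc hpo hpb] := qC; split.
- split; first by exists Z; exact: opp_zero.
  move=> X Y; have [S [i1 [i2 [p1 [p2 [h1 h2 h3 h4 h5]]]]]] := bip X Y.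
  by exists S, p1, p2, i1, i2; split.
- by move=> X Y f; have [Q [q qP]] := hc _ _ f; exists Q, q.
- by move=> X Y f; have [Q [q qP]] := hk _ _ f; exists Q, q.
- by move=> X Y Z' i g P p i'; exact: hpb.
- by move=> X Y Z' i g P p i'; exact: hpo.
Qed.

Lemma kernel_exists X Y (f : Mor X Y) : exists K (k : Mor K X), is_kernel f k.
Proof. by have [_ hk _ _ _] := qC. Qed.

Lemma cokernel_exists X Y (f : Mor X Y) : exists Q (q : Mor Y Q), is_cokernel f q.
Proof. by have [_ _ hk _ _] := qC. Qed.

Lemma biproduct_exists X Y : exists S (i1 : Mor X S) (i2 : Mor Y S) (p1 : Mor S X)
     (p2 : Mor S Y), is_biproduct i1 i2 p1 p2.
Proof. by have [[_ bip] _ _ _ _] := qC. Qed.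

Lemma pullback_exists X Y Z (f : Mor X Z) (g : Mor Y Z) :
  exists P (p : Mor P X) (q : Mor P Y), is_pullback f g p q.
Proof.
have [S [i1 [i2 [p1 [p2 [h1 h2 h3 h4 h5]]]]]] := biproduct_exists X Y.
have [P [k kP]] := kernel_exists (f ∘ p1 - g ∘ p2).
exists P, (p1 ∘ k), (p2 ∘ k); split.
  apply/eqP; rewrite -subr_eq0 !mcompA -mcompBl; apply/eqP; exact: kernel_comp0 kP.
move=> T a b ab; have [|u ku] := kernel_lift (t := i1 ∘ a + i2 ∘ b) kP.
  rewrite mcompBl !mcompDr -!(mcompA f) -!(mcompA g) !(mcompA p1) !(mcompA p2).
  by rewrite h1 h2 h3 h4 !mcomp1m !mcomp0m !mcompm0 addr0 add0r ab subrr.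
exists u; split.
  rewrite -!mcompA ku !mcompDr !(mcompA p1) !(mcompA p2).
  by rewrite h1 h2 h3 h4 !mcomp1m !mcomp0m addr0 add0r.
move=> v [va vb]; apply: (kernel_monic kP); rewrite ku -[RHS]mcomp1m -h5 mcompDl.
by rewrite -!mcompA !(mcompA p1) !(mcompA p2) va vb.
Qed.

Lemma strict_mono_kernel X Y Q (m : Mor X Y) (q : Mor Y Q) :
  strict_mono m -> is_cokernel m q -> is_kernel q m.
Proof.
move=> [W [f fm]] mq; apply: kernelP (kernel_monic fm) _.
  exact: cokernel_comp0 mq.
move=> T t qt; have [u uq] := cokernel_desc mq (kernel_comp0 fm).
by apply: (kernel_lift fm); rewrite -uq -mcompA qt mcompm0.
Qed.

(** The lifting step of every chase: [z] is a generalized element of [Z], and the cover [T'] is the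
    pullback of [e] along it. *)
Lemma strict_epi_lift X Z T (e : Mor X Z) (z : Mor T Z) :
  strict_epi e -> exists T' (e' : Mor T' T) (x : Mor T' X),
    strict_epi e' /\ e ∘ x = z ∘ e'.
Proof.
have [_ _ _ _ hpb] := qC.
move=> es; have [P [p [q pb]]] := pullback_exists e z.
by exists P, q, p; split; [exact: hpb pb es | case: pb].
Qed.

Lemma strict_epi_cokernel X Y K (e : Mor X Y) (k : Mor K X) :
  strict_epi e -> is_kernel e k -> is_cokernel k e.
Proof.
move=> [W [f fe]] ke; apply: cokernelP (cokernel_epi fe) _.
  exact: kernel_comp0 ke.
move=> T t tk; have [u ku] := kernel_lift ke (cokernel_comp0 fe).
by apply: (cokernel_desc fe); rewrite -ku mcompA tk mcomp0m.
Qed.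

(** A morphism that kills the kernel of [e' ∘ e] descends along [e]. The result kills the kernel of
    [e'], whose elements lift along [e] up to a cover and land in the kernel of [e' ∘ e]; so it
    descends once more. *)
Lemma strict_epi_comp X Y Z (e' : Mor Y Z) (e : Mor X Y) :
  strict_epi e' -> strict_epi e -> strict_epi (e' ∘ e).
Proof.
move=> e's es; have [K [k kP]] := kernel_exists (e' ∘ e).
exists K, k; apply: cokernelP; first exact: kernel_comp0 kP.
  by apply: epi_comp; exact: strict_epi_epi.
move=> T t tk; have [L [l lP]] := kernel_exists e.
have [|t' t'e] := cokernel_desc (t := t) (strict_epi_cokernel es lP).
  have [|u ku] := kernel_lift (t := l) kP.
    by rewrite -mcompA (kernel_comp0 lP) mcompm0.
  by rewrite -ku mcompA tk mcomp0m.
have [L' [l' l'P]] := kernel_exists e'.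
have [|t'' t''e'] := cokernel_desc (t := t') (strict_epi_cokernel e's l'P).
  have [T' [e1 [x [e1s ex]]]] := strict_epi_lift l' es.
  apply: (epi0 (strict_epi_epi e1s)); rewrite -mcompA -ex mcompA t'e.
  have [|u <-] := kernel_lift (t := x) kP; last by rewrite mcompA tk mcomp0m.
  by rewrite -mcompA ex mcompA (kernel_comp0 l'P) mcomp0m.
by exists t''; rewrite mcompA t''e'.
Qed.

(** If [t] kills the kernel of [g], then [t ∘ f] descends along [g ∘ f] to some [u]. Up to a cover,
    an element of [Y] differs from an element of the form [f ∘ x] by one in the kernel of [g], so
    [u ∘ g = t] on all of [Y]. *)
Lemma strict_epi_cancel X Y Z (g : Mor Y Z) (f : Mor X Y) :
  strict_epi (g ∘ f) -> strict_epi g.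
Proof.
move=> gfs; have [K [k kP]] := kernel_exists g; exists K, k.
have [L [l lP]] := kernel_exists (g ∘ f).
apply: cokernelP; first exact: kernel_comp0 kP.
  exact: epi_cancel (strict_epi_epi gfs).
move=> T t tk.
have tker W (w : Mor W Y) : g ∘ w = 0 -> t ∘ w = 0.
  by move=> /(kernel_lift kP)[u <-]; rewrite mcompA tk mcomp0m.
have [|u ug] := cokernel_desc (t := t ∘ f) (strict_epi_cokernel gfs lP).
  by rewrite -mcompA tker // mcompA (kernel_comp0 lP).
exists u; apply/esym/eqP; rewrite -subr_eq0; apply/eqP.
have [T' [e [x [es ex]]]] := strict_epi_lift g gfs.
apply: (epi0 (strict_epi_epi es)).
have : t ∘ (e - f ∘ x) = 0 by rewrite tker // mcompBr mcompA ex subrr.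
move/eqP; rewrite mcompBr subr_eq0 mcompBl => /eqP ->.
by rewrite -mcompA -ex (mcompA t) -ug !mcompA subrr.
Qed.

Lemma pullback_strict_mono X Y Z (f : Mor X Z) (m : Mor Y Z) P (p : Mor P X)
    (q : Mor P Y) : is_pullback f m p q -> strict_mono m -> strict_mono p.
Proof.
move=> [fp pU] [W [g gm]]; exists W, (g ∘ f).
have pm : is_monic p.
  move=> T a b ab; have [|u [_ uU]] := pU T (p ∘ a) (q ∘ a).
    by rewrite !mcompA fp.
  rewrite -(uU a) // -(uU b) //; split; first by rewrite ab.
  by apply: (kernel_monic gm); rewrite !mcompA -fp -!mcompA ab.
apply: kernelP pm _; first by rewrite -mcompA fp mcompA (kernel_comp0 gm) mcomp0m.
move=> T t; rewrite -mcompA => /(kernel_lift gm)[u mu].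
by have [v [[vt _] _]] := pU T t u (esym mu); exists v.
Qed.

Lemma pullback_monic X Y Z (f : Mor X Z) (m : Mor Y Z) P (p : Mor P X)
    (q : Mor P Y) : is_pullback f m p q -> is_monic m -> is_monic p.
Proof.
move=> [fp pU] mm T a b ab; have [|u [_ uU]] := pU T (p ∘ a) (q ∘ a).
  by rewrite !mcompA fp.
rewrite -(uU a) // -(uU b) //; split; first by rewrite ab.
by apply: mm; rewrite !mcompA -fp -!mcompA ab.
Qed.

Lemma short_exact_kernel X Y K (e : Mor X Y) (k : Mor K X) :
  strict_epi e -> is_kernel e k -> short_exact k e.
Proof. by move=> es ke; split=> //; exact: strict_epi_cokernel. Qed.

Lemma short_exact_cokernel X Y Q (m : Mor X Y) (q : Mor Y Q) :
  strict_mono m -> is_cokernel m q -> short_exact m q.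
Proof. by move=> ms mq; split=> //; exact: strict_mono_kernel. Qed.

(** An element of [J] killed by [v] lifts to [X] up to a cover. The lift lies in the kernel of [f],
    hence dies in [J]. *)
Lemma coimage_monic X Y J K (f : Mor X Y) (k : Mor K X) (j : Mor X J) (v : Mor J Y) :
  is_kernel f k -> is_cokernel k j -> v ∘ j = f -> is_monic v.
Proof.
move=> fk kj vj; apply: is_monicP => T z vz.
have [|T' [e [x [es jx]]]] := strict_epi_lift (e := j) z; first by exists K, k.
apply: (epi0 (strict_epi_epi es)); rewrite -jx.
have [|u <-] := kernel_lift (t := x) fk.
  by rewrite -vj -mcompA jx mcompA vz mcomp0m.
by rewrite mcompA (cokernel_comp0 kj) mcomp0m.
Qed.

Lemma strict_factor_image X Y I (f : Mor X Y) (e : Mor X I) (m : Mor I Y) :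
  is_epi e -> strict_mono m -> m ∘ e = f -> is_image f m.
Proof.
move=> ee ms fE; have [Q [q qP]] := cokernel_exists f.
exists Q, q; split=> //; apply: strict_mono_kernel ms _.
by apply: (@cokernel_of_epi_comp _ _ _ _ _ _ _ e) => //; rewrite fE.
Qed.

Lemma strict_factor_strict X Y (f : Mor X Y) : strict_factor f -> is_strict f.
Proof.
move=> [I [e [m [es ms fE]]]]; exists I, e, I, m, (idm I); split.
- have [K [k kP]] := kernel_exists f; exists K, k; split=> //.
  apply: strict_epi_cokernel es _.
  by apply: (kernel_of_monic_comp (strict_mono_monic ms)); rewrite fE.
- by apply: strict_factor_image fE => //; exact: strict_epi_epi.
- by rewrite mcompm1.
- exact: is_iso_id.
Qed.

Lemma strict_mono_strict X Y (f : Mor X Y) : strict_mono f -> strict_factor f.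
Proof.
move=> fs; exists X, (idm X), f; split=> //; last by rewrite mcompm1.
exact/strict_epi_iso/is_iso_id.
Qed.

Lemma strict_strict_factor X Y (f : Mor X Y) : is_strict f -> strict_factor f.
Proof.
move=> [J [j [I [i [u [[K [k [fk kj]]] [Q [q [fq qi]]] fE ui]]]]]].
exists J, j, (i ∘ u); split=> //; first by exists K, k.
by apply: strict_mono_isor ui _; exists Q, q.
Qed.

(** In a strict factorization of a monic, the strict epi is monic too. It is the cokernel of its
    zero kernel, hence invertible. *)
Lemma strict_monic_strict_mono X Y (f : Mor X Y) :
  is_strict_monic f <-> strict_mono f.
Proof.
split=> [[fm /strict_strict_factor[I [e [m [es ms fE]]]]]|fs]; last first.
  split; first exact: strict_mono_monic.
  exact/strict_factor_strict/strict_mono_strict.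
rewrite -fE; apply: strict_mono_isor ms.
have [K [k kP]] := kernel_exists e.
have em : is_monic e by apply: (@monic_cancel _ _ _ _ m); rewrite fE.
have k0 : k = 0 by apply: em; rewrite (kernel_comp0 kP) mcompm0.
have [|u ue] := cokernel_desc (t := idm X) (strict_epi_cokernel es kP).
  by rewrite k0 mcompm0.
exists u; split=> //; apply: (strict_epi_epi es).
by rewrite -mcompA ue mcompm1 mcomp1m.
Qed.

(* The rows i, p and j, q of the diagram are short exact, and c' is the cokernel
   of f'. Lifting k'' : K'' -> M'' to M up to a strict epi and applying f gives
   the connecting morphism K'' -> C', which the hypothesis [hom0] kills. *)
Section SnakeKernel.
Variables (M' M M'' N' N N'' : C).
Variables (i : Mor M' M) (p : Mor M M'') (j : Mor N' N) (q : Mor N N'').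
Variables (f' : Mor M' N') (f : Mor M N) (f'' : Mor M'' N'').
Hypotheses (ip : short_exact i p) (jq : short_exact j q).
Hypotheses (fi : f ∘ i = j ∘ f') (fq : q ∘ f = f'' ∘ p).
Hypothesis f's : strict_factor f'.

Variables (K' K K'' C' : C) (k' : Mor K' M') (k : Mor K M) (k'' : Mor K'' M'')
  (c' : Mor N' C').
Hypotheses (k'P : is_kernel f' k') (kP : is_kernel f k) (k''P : is_kernel f'' k'')
  (c'P : is_cokernel f' c').
Hypothesis hom0 : forall d : Mor K'' C', d = 0.

Variables (ik : Mor K' K) (pk : Mor K K'').
Hypotheses (ikE : k ∘ ik = i ∘ k') (pkE : k'' ∘ pk = p ∘ k).

Lemma snake_kernel_strict_epi : strict_epi pk.
Proof.
have pe : strict_epi p by exists M', i; case: ip.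
have [T1 [e1 [m [e1s pm]]]] := strict_epi_lift k'' pe.
have [|n jn] := kernel_lift (t := f ∘ m) jq.1.
  by rewrite mcompA fq -mcompA pm mcompA (kernel_comp0 k''P) mcomp0m.
(* Changing the lift [m] changes [n] by something in the image of [f'], so [c' ∘ n] descends along
   the cover [e1] to the connecting morphism [d]. *)
have c'n : c' ∘ n = 0.
  have [L [l lP]] := kernel_exists e1.
  have [|d <-] := cokernel_desc (t := c' ∘ n) (strict_epi_cokernel e1s lP).
    have [|m' im'] := kernel_lift (t := m ∘ l) ip.1.
      by rewrite mcompA pm -mcompA (kernel_comp0 lP) mcompm0.
    have nl : n ∘ l = f' ∘ m'.
      by apply: (kernel_monic jq.1); rewrite !mcompA jn -fi -!mcompA im'.
    by rewrite -mcompA nl mcompA (cokernel_comp0 c'P) mcomp0m.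
  by rewrite (hom0 d) mcomp0m.
(* Strictness of [f'] makes [mI] the kernel of [c'], so [n] lifts along [f'] after a further
   cover. *)
have [I [e [mI [es mIs f'E]]]] := f's.
have [|y my] := kernel_lift (f := c') (k := mI) (t := n) _ c'n.
  apply: strict_mono_kernel mIs _.
  by apply: (cokernel_of_epi_comp (strict_epi_epi es)); rewrite f'E.
have [T2 [e2 [w [e2s ew]]]] := strict_epi_lift y es.
(* Subtracting [i ∘ w] puts the lift into the kernel of [f] without changing its image in [M'']. *)
have [|z kz] := kernel_lift (t := m ∘ e2 - i ∘ w) kP.
  by rewrite mcompBr !mcompA fi -jn -!mcompA -f'E -(mcompA mI) ew (mcompA mI) my subrr.
have pz : pk ∘ z = e1 ∘ e2.
  apply: (kernel_monic k''P).
  by rewrite mcompA pkE -mcompA kz mcompBr !mcompA (kernel_comp0 ip.1) mcomp0m subr0 pm.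
by apply: (@strict_epi_cancel _ _ _ pk z); rewrite pz; exact: strict_epi_comp.
Qed.

Lemma snake_kernel_kernel : is_kernel pk ik.
Proof.
apply: kernelP.
- apply: (kernel_monic k''P).
  by rewrite mcompA pkE -mcompA ikE mcompA (kernel_comp0 ip.1) mcomp0m mcompm0.
- apply: (@monic_cancel _ _ _ _ k); rewrite ikE.
  by apply: monic_comp; [exact: kernel_monic ip.1 | exact: kernel_monic k'P].
- move=> T t pkt; have [|m im] := kernel_lift (t := k ∘ t) ip.1.
    by rewrite mcompA -pkE -mcompA pkt mcompm0.
  have [|u ku] := kernel_lift (t := m) k'P.
    apply: (kernel_monic jq.1).
    by rewrite mcompA -fi -mcompA im mcompA (kernel_comp0 kP) mcomp0m mcompm0.
  by exists u; apply: (kernel_monic kP); rewrite mcompA ikE -mcompA ku.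
Qed.

Lemma snake_kernel : short_exact ik pk.
Proof.
exact: short_exact_kernel snake_kernel_strict_epi snake_kernel_kernel.
Qed.

End SnakeKernel.

End QuasiAbelian.

(** * The dual half of the snake lemma, and strictness of the middle morphism *)

Section QuasiAbelianDual.
Variable C : preadditive.
Hypothesis qC : is_quasi_abelian C.
Implicit Types X Y Z T : C.
Let qO := opp_quasi_abelian qC.

Lemma strict_mono_comp X Y Z (m' : Mor Y Z) (m : Mor X Y) :
  strict_mono m' -> strict_mono m -> strict_mono (m' ∘ m).
Proof. by move=> m's ms; exact: (strict_epi_comp qO ms m's). Qed.

Lemma strict_mono_cancel X Y Z (g : Mor Y Z) (f : Mor X Y) :
  strict_mono (g ∘ f) -> strict_mono f.
Proof. exact: (@strict_epi_cancel _ qO). Qed.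

Lemma image_epi X Y I Q (f : Mor X Y) (q : Mor Y Q) (i : Mor I Y) (v : Mor X I) :
  is_cokernel f q -> is_kernel q i -> i ∘ v = f -> is_epi v.
Proof. exact: (@coimage_monic _ qO). Qed.

Section Snake.
Variables (M' M M'' N' N N'' : C).
Variables (i : Mor M' M) (p : Mor M M'') (j : Mor N' N) (q : Mor N N'').
Variables (f' : Mor M' N') (f : Mor M N) (f'' : Mor M'' N'').
Hypotheses (ip : short_exact i p) (jq : short_exact j q).
Hypotheses (fi : f ∘ i = j ∘ f') (fq : q ∘ f = f'' ∘ p).
Hypotheses (f's : strict_factor f') (f''s : strict_factor f'').

Variables (K'' C' : C) (k'' : Mor K'' M'') (c' : Mor N' C').
Hypotheses (k''P : is_kernel f'' k'') (c'P : is_cokernel f' c').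
Hypothesis hom0 : forall d : Mor K'' C', d = 0.

(** The situation is self-dual: passing to [opp_cat C] exchanges the rows, [f'] with [f''] and [K'']
    with [C'], and [hom0] keeps its form. *)
Lemma snake_cokernel (Q Q'' : C) (c : Mor N Q) (c'' : Mor N'' Q'')
    (jc : Mor C' Q) (qc : Mor Q Q'') :
  is_cokernel f c -> is_cokernel f'' c'' ->
  jc ∘ c' = c ∘ j -> qc ∘ c = c'' ∘ q -> short_exact jc qc.
Proof.
move=> cP c''P jcE qcE.
have := @snake_kernel (opp_cat C) qO N'' N N' M'' M M' q j p i f'' f f'
  (short_exact_opp jq) (short_exact_opp ip) fq fi
  (strict_factor_opp f''s) _ _ _ _ c'' c c' k'' c''P cP c'P k''P hom0 qc jc qcE jcE.
by case=> ? ?; split.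
Qed.

(** It has to be seen that [M] maps onto the image [I] of [f] by a strict epi. Given an element of
    [I], strictness of [f''] yields an element of [M] with the same image in [N''], up to a cover.
    The difference comes from [N'] and dies in [Q], hence in [C'] because [jc] is monic. Strictness
    of [f'] then lifts it to [M']. *)
Lemma snake_strict : strict_factor f.
Proof.
have [Q [c cP]] := cokernel_exists qC f.
have [Q'' [c'' c''P]] := cokernel_exists qC f''.
have [|jc jcE] := cokernel_desc (t := c ∘ j) c'P.
  by rewrite -mcompA -fi mcompA (cokernel_comp0 cP) mcomp0m.
have [|qc qcE] := cokernel_desc (t := c'' ∘ q) cP.
  by rewrite -mcompA fq mcompA (cokernel_comp0 c''P) mcomp0m.
have jcm : is_monic jc by case: (snake_cokernel cP c''P jcE qcE) => /kernel_monic.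
have [I [m mP]] := kernel_exists qC c.
have [e me] := kernel_lift mP (cokernel_comp0 cP).
exists I, e, m; split=> //; last by exists Q, c.
have [I'' [e'' [m'' [e''s m''s f''E]]]] := f''s.
have [I' [e' [m' [e's m's f'E]]]] := f's.
have [||y my] := kernel_lift (f := c'') (k := m'') (t := q ∘ m).
- apply: strict_mono_kernel m''s _.
  by apply: (cokernel_of_epi_comp (strict_epi_epi e''s)); rewrite f''E.
- by rewrite mcompA -qcE -mcompA (kernel_comp0 mP) mcompm0.
have pe : strict_epi p by exists M', i; case: ip.
have [T [e1 [x [e1s ex]]]] := strict_epi_lift qC y (strict_epi_comp qC e''s pe).
have [|n jn] := kernel_lift (t := m ∘ e1 - f ∘ x) jq.1.
  by rewrite mcompBr !mcompA fq -my -!mcompA -ex -f''E !mcompA subrr.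
have [||w mw] := kernel_lift (f := c') (k := m') (t := n).
- apply: strict_mono_kernel m's _.
  by apply: (cokernel_of_epi_comp (strict_epi_epi e's)); rewrite f'E.
- apply: (monic0 jcm); rewrite mcompA jcE -mcompA jn mcompBr !mcompA.
  by rewrite (kernel_comp0 mP) (cokernel_comp0 cP) !mcomp0m subrr.
have [T2 [e2 [v [e2s ev]]]] := strict_epi_lift qC w e's.
have ev' : e ∘ (x ∘ e2 + i ∘ v) = e1 ∘ e2.
  apply: (kernel_monic mP); rewrite mcompA me mcompDr !mcompA fi.
  rewrite -f'E -!mcompA ev (mcompA m') mw (mcompA j) jn mcompBl.
  by rewrite !mcompA addrC subrK.
apply: (strict_epi_cancel qC (f := x ∘ e2 + i ∘ v)); rewrite ev'.
exact: strict_epi_comp.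
Qed.

End Snake.
End QuasiAbelianDual.

(** * Slopes and semistable objects *)
Section OrderedGroup.
Variable L : divOrderedGroup.
Implicit Types x y : L.

Lemma dog_subr_ge0 x y : 0 <= y - x <-> x <= y.
Proof.
split=> [/(dog_leD2l x)|/(dog_leD2l (- x))]; first by rewrite addr0 addrC subrK.
by rewrite addNr addrC.
Qed.

Lemma dog_oppr_ge0 x : 0 <= - x <-> x <= 0.
Proof. by rewrite -[- x]add0r; exact: dog_subr_ge0. Qed.

Lemma dog_addr_ge0 x y : 0 <= x -> 0 <= y -> 0 <= x + y.
Proof. by move=> x0 /(dog_leD2l x); rewrite addr0; exact: le_trans. Qed.

Lemma dog_mulrn_ge0 x n : 0 <= x -> 0 <= x *+ n.
Proof. by move=> x0; elim: n => // n IH; rewrite mulrS; exact: dog_addr_ge0. Qed.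

(** Uniqueness of division by [n] is torsion-freeness. *)
Lemma dog_mulrn_eq0 x n : (0 < n)%N -> x *+ n = 0 -> x = 0.
Proof.
move=> n0 xn; have [y [_ yU]] := dog_divisible n0 (0 : L).
by rewrite -(yU x) // (yU 0) // mul0rn.
Qed.

Lemma dog_pmulrn_ge0 x n : (0 < n)%N -> 0 <= x *+ n <-> 0 <= x.
Proof.
move=> n0; split=> [xn|]; last exact: dog_mulrn_ge0.
have [//|x0] := dog_le_or_lt 0 x.
have nx : 0 <= - x by apply/dog_oppr_ge0/ltW.
have : x *+ n <= 0 by apply/dog_oppr_ge0; rewrite -mulNrn; exact: dog_mulrn_ge0.
move=> xn'; have /(dog_mulrn_eq0 n0) -> // : x *+ n = 0.
by apply/eqP; rewrite eq_le xn xn'.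
Qed.

Lemma dog_subr_gt0 x y : 0 < y - x <-> x < y.
Proof.
rewrite !lt_neqAle; split=> /andP[h1 h2]; apply/andP; split.
- by apply: contraNneq h1 => ->; rewrite subrr.
- exact/dog_subr_ge0.
- by apply: contraNneq h1 => /eqP; rewrite eq_sym subr_eq0 => /eqP ->.
- exact/dog_subr_ge0.
Qed.

Lemma dog_pmulrn_gt0 x n : (0 < n)%N -> 0 < x -> 0 < x *+ n.
Proof.
move=> n0 x0; rewrite lt_neqAle dog_mulrn_ge0 ?ltW// andbT eq_sym.
by apply/eqP => /(dog_mulrn_eq0 n0) x0'; rewrite x0' ltxx in x0.
Qed.

End OrderedGroup.

Section Semistable.
Variables (A : quasiAbelianCat) (L : divOrderedGroup).
Variables (rk : A -> nat) (deg : A -> L).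
Hypotheses (hrk : rank_function rk) (hdeg : degree_function deg)
  (hslope : slope_function rk deg).
Implicit Types M N P : A.
Let qA := qa_quasi_abelian A.

(* A nonzero [M] has slope [<= l] iff [defect l M >= 0]; unlike the slope, the
   defect is additive. *)
Definition defect (l : L) M : L := l *+ rk M - deg M.

(** Membership in [A(l)] (see [pureP]) put in terms of the additive defect, so that zero objects
    need no separate case. *)
Definition pure (l : L) M : Prop :=
  defect l M = 0 /\ forall N (f : Mor N M), is_monic f -> 0 <= defect l N.

Lemma defectD l M N P (f : Mor M N) (g : Mor N P) :
  short_exact f g -> defect l N = defect l M + defect l P.
Proof.
move=> fg; have [_ rkD _] := hrk; have [_ degD] := hdeg.
by rewrite /defect (rkD _ _ _ _ _ fg) (degD _ _ _ _ _ fg) mulrnDr opprD addrACA.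
Qed.

Lemma defect_iso l M N (f : Mor M N) : is_iso f -> defect l M = defect l N.
Proof.
move=> fi; have [rkI _ _] := hrk; have [degI _] := hdeg.
by rewrite /defect (rkI M N) ?(degI M N) //; exists f.
Qed.

Lemma defect_zero l M : is_zero M -> defect l M = 0.
Proof.
move=> M0; apply/esym; apply: (@addrI _ (defect l M)); rewrite addr0.
(* For a zero object, [M -> M -> M] is short exact, so the defect equals its double. *)
apply: (@defectD l _ _ _ (0 : Mor M M) (0 : Mor M M)).
have h (X : A) (f g : Mor M X) : f = g by exact: zero_mor.
have h' (X : A) (f g : Mor X M) : f = g by exact: mor_zero.
by split; split=> // T t _; exists 0; split.
Qed.

Lemma rk_gt0 M : ~ is_zero M -> (0 < rk M)%N.
Proof. by have [_ _ rk0] := hrk; rewrite lt0n => /rk0 /eqP. Qed.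

Lemma defectE l M : ~ is_zero M -> defect l M = (l - slope rk deg M) *+ rk M.
Proof. by move=> /rk_gt0 M0; rewrite /defect mulrnBl /slope dog_divK. Qed.

Lemma slope_le l M : ~ is_zero M -> slope rk deg M <= l <-> 0 <= defect l M.
Proof.
move=> M0; rewrite defectE //; apply: iff_trans (iff_sym (dog_subr_ge0 _ _)) _.
by apply: iff_sym; apply: dog_pmulrn_ge0; exact: rk_gt0.
Qed.

Lemma slope_ge l M : ~ is_zero M -> l <= slope rk deg M <-> defect l M <= 0.
Proof.
move=> M0; rewrite defectE //; apply: iff_trans (iff_sym (dog_subr_ge0 _ _)) _.
apply: iff_trans (dog_oppr_ge0 _); rewrite -mulNrn opprB.
by apply: iff_sym; apply: dog_pmulrn_ge0; exact: rk_gt0.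
Qed.

Lemma slope_eq l M : ~ is_zero M -> slope rk deg M = l <-> defect l M = 0.
Proof.
move=> M0; split=> [<-|d0]; first by rewrite defectE // subrr mul0rn.
by apply/eqP; rewrite eq_le; apply/andP; split; [apply/slope_le|apply/slope_ge];
  rewrite // d0.
Qed.

Lemma pureP l M : semistable_of_slope rk deg l M <-> pure l M.
Proof.
split=> [[M0|[[M0 Mss] Ml]]|[d0 Mss]].
- split=> [|N f fm]; first exact: defect_zero.
  by rewrite defect_zero //; exact: monic_to_zero fm M0.
- split=> [|N f fm]; first exact/slope_eq.
  have [N0|N0] := EM (is_zero N); first by rewrite defect_zero.
  by apply/slope_le => //; rewrite -Ml; exact: Mss f fm N0.
- have [M0|M0] := EM (is_zero M); [by left | right].
  have Ml : slope rk deg M = l by exact/slope_eq.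
  split=> //; split=> // N f fm N0.
  by rewrite Ml; apply/slope_le => //; exact: Mss fm.
Qed.

Lemma pure_iso l M N (f : Mor M N) : is_iso f -> pure l M -> pure l N.
Proof.
move=> fi [d0 Mss]; split=> [|P g gm]; first by rewrite -(defect_iso l fi).
have [f' [_ ff' f'i]] := is_iso_inv fi.
by apply: (Mss P (f' ∘ g)); apply: monic_comp gm; exact: iso_monic.
Qed.

Lemma pure_zero l M : is_zero M -> pure l M.
Proof. by move=> M0; apply/pureP; left. Qed.

(** For nonzero objects, defect at most 0 means slope at least [l], and an epi-monic can only raise
    the slope. If [N] has slope exactly [l], both slopes agree and the equality case of
    [slope_function] applies. *)
Lemma monic_epi_defect l M N (u : Mor M N) :
  is_monic u -> is_epi u -> defect l M <= 0 ->
  defect l N <= 0 /\ (defect l N = 0 -> is_iso u).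
Proof.
move=> um ue dM; have [M0|M0] := EM (is_zero M).
  have N0 := epi_from_zero ue M0.
  by rewrite (defect_zero l N0); split=> // _; exact: zero_iso.
have N0 : ~ is_zero N by move=> /(monic_to_zero um).
have [sMN eqMN] := hslope M0 N0 um ue.
have lM : l <= slope rk deg M by exact/slope_ge.
have lN := le_trans lM sMN.
split=> [|/(slope_eq l N0) Nl]; first exact/slope_ge.
by apply/eqMN/eqP; rewrite eq_le sMN Nl lM.
Qed.

(** A subobject [X] of [N] is an extension of a subobject [J] of [P] by a subobject [K] of [M], and
    defects add. *)
Lemma pure_ext l M N P (f : Mor M N) (g : Mor N P) :
  short_exact f g -> pure l M -> pure l P -> pure l N.
Proof.
move=> fg [dM Mss] [dP Pss]; split=> [|X x xm].
  by rewrite (defectD l fg) dM dP addr0.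
have [K [k kP]] := kernel_exists qA (g ∘ x).
have [J [j jP]] := cokernel_exists qA k.
have [v vj] := cokernel_desc jP (kernel_comp0 kP).
have vm := coimage_monic qA kP jP vj.
have km : strict_mono k by exists P, (g ∘ x).
rewrite (defectD l (short_exact_cokernel km jP)); apply: dog_addr_ge0; last exact: Pss vm.
have [|y fy] := kernel_lift (t := x ∘ k) fg.1; first by rewrite mcompA (kernel_comp0 kP).
apply: (Mss _ y); apply: (@monic_cancel _ _ _ _ f); rewrite fy.
by apply: monic_comp xm (kernel_monic kP).
Qed.

Section PureMorphism.
Variables (l m : L) (M N : A) (f : Mor M N).
Hypotheses (Ml : pure l M) (Nm : pure m N).

(** The slope of [I] is bounded from both sides. As [K] is a subobject of [M], the quotient [J] has
    slope at least [l]; the epi-monic [u] only raises it, and [I] is a subobject of [N]. *)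
Lemma pure_factor : exists (K J I Q : A) (k : Mor K M) (j : Mor M J) (u : Mor J I)
    (i : Mor I N) (q : Mor N Q),
  [/\ short_exact k j, short_exact i q, is_monic u, is_epi u & i ∘ u ∘ j = f] /\
  [/\ is_kernel f k, is_cokernel f q, 0 <= defect l K, defect l I <= 0
    & 0 <= defect m I].
Proof.
have [[dM Mss] [dN Nss]] := (Ml, Nm).
have [K [k kP]] := kernel_exists qA f.
have [J [j jP]] := cokernel_exists qA k.
have [Q [q qP]] := cokernel_exists qA f.
have [I [i iP]] := kernel_exists qA q.
have ks : strict_mono k by exists N, f.
have [v vj] := cokernel_desc jP (kernel_comp0 kP).
have vm := coimage_monic qA kP jP vj.
have [w iw] := kernel_lift iP (cokernel_comp0 qP).
have we := image_epi qA qP iP iw.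
have [|u iu] := kernel_lift (t := v) iP.
  by apply: (epi0 (cokernel_epi jP)); rewrite -mcompA vj (cokernel_comp0 qP).
have um : is_monic u by apply: (@monic_cancel _ _ _ _ i); rewrite iu.
have ue : is_epi u.
  apply: (@epi_cancel _ _ _ _ _ j); suff -> : u ∘ j = w by [].
  by apply: (kernel_monic iP); rewrite mcompA iu vj iw.
have dK : 0 <= defect l K by exact: Mss (kernel_monic kP).
have kj := short_exact_cokernel ks jP.
have dJ : defect l J <= 0.
  apply/dog_oppr_ge0; suff <- : defect l K = - defect l J by [].
  by apply/eqP; rewrite -addr_eq0 -(defectD l kj) dM.
exists K, J, I, Q, k, j, u, i, q; split; split=> //.
- by apply: short_exact_kernel iP => //; exists M, f.
- by rewrite iu.
- by have [] := monic_epi_defect um ue dJ.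
- exact: Nss (kernel_monic iP).
Qed.

(** A nonzero [I] would have slope at least [l] and at most [m]. In defects, the positive element
    [(l - m) *+ rk I] equals [defect l I - defect m I], which is at most 0. *)
Lemma pure_hom0 : m < l -> f = 0.
Proof.
move=> ml; have [K [J [I [Q [k [j [u [i [q [[_ _ _ _ <-] [_ _ _ dI dI']]]]]]]]]]] := pure_factor.
suff I0 : is_zero I by rewrite (mor_zero u 0 I0) mcompm0 mcomp0m.
apply: contrapT => I0.
have : 0 < (l - m) *+ rk I by apply: dog_pmulrn_gt0; [exact: rk_gt0 | exact/dog_subr_gt0].
have -> : (l - m) *+ rk I = defect l I - defect m I.
  by rewrite /defect mulrnBl opprB addrA subrK.
rewrite lt_neqAle => /andP[n0 /dog_subr_ge0 h].
have dI0 : defect l I = 0 by apply/eqP; rewrite eq_le dI (le_trans dI').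
have dI0' : defect m I = 0 by apply/eqP; rewrite eq_le dI' -dI0 h.
by move: n0; rewrite dI0 dI0' subrr eqxx.
Qed.

(** With equal slopes the two bounds on [I] force its defect to vanish. Then [J] and [I] have the
    same defect, [u] is invertible, and additivity gives defect 0 for [K] and [Q]. *)
Lemma pure_strict : l = m ->
  [/\ strict_factor f, forall K (k : Mor K M), is_kernel f k -> pure l K
    & forall Q (q : Mor N Q), is_cokernel f q -> pure l Q].
Proof.
move=> lm; have [K [J [I [Q [k [j [u [i [q [[kj iq um ue fE] [kP qP dK dI dI']]]]]]]]]]]
  := pure_factor.
have [[dM Mss] [dN Nss]] := (Ml, Nm).
rewrite -lm in dI' dN Nss.
have dI0 : defect l I = 0 by apply/eqP; rewrite eq_le dI dI'.
have dJ : defect l J <= 0.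
  apply/dog_oppr_ge0; suff <- : defect l K = - defect l J by [].
  by apply/eqP; rewrite -addr_eq0 -(defectD l kj) dM.
have ui : is_iso u by have [_] := monic_epi_defect um ue dJ; apply.
have dQ : defect l Q = 0 by move: (defectD l iq); rewrite dN dI0 add0r.
have dK0 : defect l K = 0.
  by move: (defectD l kj); rewrite dM (defect_iso l ui) dI0 addr0.
split.
- exists I, (u ∘ j), i; split; last by rewrite mcompA.
    by apply: strict_epi_isol => //; exists K, k; case: kj.
  by exists Q, q; case: iq.
- move=> K1 k1 /(kernel_uniq kP)[t ti _]; have [t' [_ _ t'i]] := is_iso_inv ti.
  apply: (pure_iso t'i); split=> // X x xm.
  by apply: (Mss X (k ∘ x)); apply: monic_comp xm; exact: kernel_monic kP.
- move=> Q1 q1 /(cokernel_uniq qP)[t ti _].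
  apply: (pure_iso ti); split=> // X x xm.
  (* Semistability speaks of subobjects only, so a subobject [X] of the quotient is pulled back to
     [N]. The pullback [P] is an extension of [X] by a copy of [I], which has defect 0. *)
  have [P [p [p' pb]]] := pullback_exists qA q x.
  have pm := pullback_monic pb xm.
  have [_ _ _ _ hpb] := qA.
  have p's : strict_epi p'.
    by apply: (hpb _ _ _ _ _ _ _ _ pb); exists I, i; case: iq.
  have [K1 [k1 k1P]] := kernel_exists qA p'.
  have := Nss _ _ pm; rewrite (defectD l (short_exact_kernel p's k1P)).
  suff -> : defect l K1 = 0 by rewrite add0r.
  rewrite -dI0; have [qp pU] := pb.
  have [|a ia] := kernel_lift (t := p ∘ k1) iq.1.
    by rewrite mcompA qp -mcompA (kernel_comp0 k1P) mcompm0.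
  have [|b [[pb1 pb2] _]] := pU I i 0; first by rewrite mcompm0 (kernel_comp0 iq.1).
  have [c kc] := kernel_lift k1P pb2.
  apply: (defect_iso l (f := a)); exists c; split.
    apply: (kernel_monic k1P); apply: pm.
    by rewrite mcompm1 -ia (mcompA k1) kc mcompA pb1.
  by apply: (kernel_monic iq.1); rewrite mcompA ia mcompm1 -mcompA kc pb1.
Qed.

End PureMorphism.
End Semistable.

(** * Breaks and graded pieces of filtrations *)
Section Breaks.
Variables (L : divOrderedGroup) (A : quasiAbelianCat).
Implicit Types (W : diagram L A) (s : seq L) (l m b c : L).
Let qA := qa_quasi_abelian A.

Lemma dmapM' W l m n (hmn : m <= n) (hlm : l <= m) :
  dmap W hmn ∘ dmap W hlm = dmap W (le_trans hlm hmn).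
Proof. exact: dmapM. Qed.

Lemma dmap_irr W l m (h h' : l <= m) : dmap W h = dmap W h'.
Proof. by congr dmap; exact: Prop_irrelevance. Qed.

Lemma dog_ltNge l m : (l < m) = ~~ (m <= l).
Proof.
have [ml|lm] := dog_le_or_lt m l; first by rewrite ml le_gtF.
by rewrite lm lt_geF.
Qed.

Lemma dog_seq_max s : s <> [::] -> exists2 b, b \in s & forall c, c \in s -> c <= b.
Proof.
elim: s => // a [|a' s] IH _; first by exists a; rewrite ?mem_head // => c; rewrite inE => /eqP ->.
have [//|b bs bmax] := IH.
have [ab|ba] := dog_le_or_lt a b.
  by exists b; [rewrite inE bs orbT | move=> c; rewrite inE => /orP[/eqP ->|/bmax]].
exists a; first exact: mem_head.
by move=> c; rewrite inE => /orP[/eqP ->//|/bmax cb]; exact: le_trans cb (ltW ba).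
Qed.

(* The transition morphisms of [W] are strict monics, isomorphisms away from
   the (unsorted, possibly redundant) list [s]. *)
Definition adapted s W : Prop :=
  [/\ forall l, (forall b, b \in s -> l < b) -> is_zero (W l),
      forall l m (h : l <= m), (forall b, b \in s -> l < b -> m < b) ->
        is_iso (dmap W h)
    & forall l m (h : l <= m), strict_mono (dmap W h)].

Lemma adapted_sub s s' W : {subset s <= s'} -> adapted s W -> adapted s' W.
Proof.
move=> ss' [W0 Wi Wm]; split=> // [l sl|l m h sl].
  by apply: W0 => b /ss'; exact: sl.
by apply: Wi => b /ss'; exact: sl.
Qed.

(** The colimit cocone with apex [W l0]: [c m] is the transition morphism below [l0] and the inverse
    of one above. It serves both to construct a colimit and to compare with a given one. *)
Lemma stable_cocone W l0 : (forall m (h : l0 <= m), is_iso (dmap W h)) ->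
  exists c : forall m, Mor (W m) (W l0),
  [/\ forall m n (h : m <= n), c n ∘ dmap W h = c m, c l0 = idm _
    & forall T (t : forall m, Mor (W m) T),
        (forall m n (h : m <= n), t n ∘ dmap W h = t m) ->
        forall m, t l0 ∘ c m = t m].
Proof.
move=> isoW.
have ex m : exists t : Mor (W m) (W l0),
    (forall h : l0 <= m, t ∘ dmap W h = idm _ /\ dmap W h ∘ t = idm _) /\
    (forall h : m <= l0, t = dmap W h).
  have [lm|ml] := dog_le_or_lt l0 m.
    have [t [t1 t2]] := isoW m lm; exists t; split=> h.
      by rewrite (dmap_irr W h lm).
    by rewrite -[RHS]mcomp1m -t1 -mcompA (dmapM _ _ _ (lexx m)) dmap1 mcompm1.
  exists (dmap W (ltW ml)); split=> h; last exact: dmap_irr.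
  by move: (le_lt_trans h ml); rewrite ltxx.
pose c m := sval (cid (ex m)).
have cP m : (forall h : l0 <= m, c m ∘ dmap W h = idm _ /\ dmap W h ∘ c m = idm _) /\
    (forall h : m <= l0, c m = dmap W h) by rewrite /c; case: cid.
exists c; split.
- move=> m n h; have [lm|ml] := dog_le_or_lt l0 m.
    rewrite -[LHS]mcompm1 -((cP m).1 lm).2 -!mcompA (mcompA (dmap W h)) dmapM'.
    by rewrite mcompA ((cP n).1 _).1 mcomp1m.
  have [ln|nl] := dog_le_or_lt l0 n.
    by rewrite (cP m).2 ?ltW // => hm; rewrite -(dmapM _ hm ln h) mcompA ((cP n).1 _).1 mcomp1m.
  by rewrite (cP m).2 ?ltW // (cP n).2 ?ltW // => h1 h2; rewrite (dmapM _ _ _ h2).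
- by rewrite ((cP l0).2 (lexx l0)) dmap1.
- move=> T t tP m; have [lm|ml] := dog_le_or_lt l0 m.
    by rewrite -(tP _ _ lm) -mcompA ((cP m).1 lm).2 mcompm1.
  by rewrite (cP m).2 ?ltW // => h; rewrite tP.
Qed.

Lemma colim_in_iso W (M : colimit predT W) l0 (Pl : predT l0) :
  (forall m (h : l0 <= m), is_iso (dmap W h)) -> is_iso (colim_in M Pl).
Proof.
move=> /stable_cocone[c [cP c1 cU]].
have [|u [uP _]] := @colim_univ _ _ _ _ _ M (W l0) (fun m _ => c m).
  by move=> m n _ _ h; exact: cP.
exists u; split; first by rewrite uP.
apply: colim_ext => m Pm; rewrite -mcompA uP mcomp1m.
rewrite (Prop_irrelevance Pl isT) (Prop_irrelevance Pm isT).
apply: (cU M (fun m => colim_in M (isT : predT m))) => m' n h.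
exact: colim_cocone.
Qed.

Lemma stable_colimit W l0 : (forall m (h : l0 <= m), is_iso (dmap W h)) ->
  exists _ : colimit predT W, True.
Proof.
move=> /stable_cocone[c [cP c1 cU]].
unshelve eexists (@Colimit _ _ _ predT W (W l0) (fun m _ => c m) _ _) => //.
move=> T t tP; exists (t l0 isT); split=> [m Pm|u uP].
  rewrite (cU T (fun m => t m isT)) => [|m' n h]; last exact: tP.
  by congr (t m _); exact: Prop_irrelevance.
by rewrite -(uP l0) c1 mcompm1.
Qed.

(** Either nothing lies below level [l], or the largest break [b] below [l] gives a single level
    [W_b] that stands for [W_{<l}]. *)
Lemma break_below s l : (forall b, b \in s -> l <= b) \/
  exists b, [/\ b \in s, b < l & forall c, c \in s -> c < l -> c <= b].
Proof.
have [/dog_seq_max[b]|] := EM ([seq b <- s | b < l] <> [::]).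
  rewrite mem_filter => /andP[bl bs] bmax; right; exists b; split=> // c cs cl.
  by apply: bmax; rewrite mem_filter cl.
move=> /contrapT s0; left=> b bs; have [//|bl] := dog_le_or_lt l b.
have : b \in [seq b <- s | b < l] by rewrite mem_filter bl.
by rewrite s0.
Qed.

Lemma adapted_below0 s W l : adapted s W -> (forall b, b \in s -> l <= b) ->
  forall m, m < l -> is_zero (W m).
Proof. by move=> [W0 _ _] sl m ml; apply: W0 => b /sl; exact: lt_le_trans. Qed.

Lemma adapted_below s W l b : adapted s W -> (forall c, c \in s -> c < l -> c <= b) ->
  forall m (h : b <= m), m < l -> is_iso (dmap W h).
Proof.
move=> [_ Wi _] sl m h ml; apply: Wi => c cs bc.
have [lc|cl] := dog_le_or_lt l c; first exact: lt_le_trans lc.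
by move: (le_lt_trans (sl _ cs cl) bc); rewrite ltxx.
Qed.

Lemma seq_bound s : exists l0, forall b, b \in s -> b <= l0.
Proof.
have [//|l0 _ h] := @dog_seq_max (0 :: s).
by exists l0 => b bs; apply: h; rewrite inE bs orbT.
Qed.

Lemma adapted_above s W l0 : adapted s W -> (forall b, b \in s -> b <= l0) ->
  forall m (h : l0 <= m), is_iso (dmap W h).
Proof.
move=> [_ Wi _] sl m h; apply: Wi => b /sl bl /(le_lt_trans bl).
by rewrite ltxx.
Qed.

Lemma adapted_filtration s W : adapted s W -> is_filtration (W : fun_cat L A).
Proof.
move=> aW; have [l0 sl0] := seq_bound s.
have [M _] := stable_colimit (adapted_above aW sl0).
have Mi l : (forall b, b \in s -> b <= l) -> is_iso (colim_in M (isT : predT l)).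
  by move=> sl; apply: colim_in_iso; exact: adapted_above aW sl.
exists M; split.
  move=> l; apply/(strict_monic_strict_mono qA).
  have [l0l|/ltW ll0] := dog_le_or_lt l0 l.
    by apply/strict_mono_iso/Mi => b /sl0 bl; exact: le_trans bl l0l.
  rewrite -(@colim_cocone _ _ _ _ _ M l l0 isT isT ll0).
  apply: (strict_mono_comp qA); first exact/strict_mono_iso/Mi.
  by case: aW.
have [W0 Wi _] := aW.
have [M0|M0] := EM (is_zero (colim M)); first by exists [::]; split.
have s_neq0 : s <> [::].
  move=> s0; apply: M0; apply: iso_zero (Mi l0 sl0) _.
  by apply: W0; rewrite s0.
pose s' := sort <=%R (undup s).
have s's b : b \in s' = (b \in s) by rewrite mem_sort mem_undup.
have sort_s' : sorted <=%R s' by apply: sort_sorted; exact: dog_total.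
have sort_lt : sorted <%R s'.
  by rewrite (@lt_sorted_uniq_le _ L) sort_uniq undup_uniq.
have leq_s' := le_sorted_leq_nth 0 sort_s'.
exists s'; split=> //.
- split=> // s'0; case: s_neq0; case: (s) s's => // a t /(_ a).
  by rewrite s'0 mem_head.
- move=> s'0 l ll; apply: W0 => b; rewrite -s's => /(nthP 0)[i si <-].
  by apply: lt_le_trans ll _; apply: (leq_s').
- move=> i si l h ll; apply: Wi => b; rewrite -s's => /(nthP 0)[k sk <-] ib.
  apply: lt_le_trans ll _; apply: (leq_s') => //.
  rewrite ltnNge; apply/negP => ki; move: ib.
  by rewrite dog_ltNge leq_s' // inE ltnW.
- move=> s'0 l ll; apply: Mi => b; rewrite -s's => /(nthP 0)[k sk <-].
  apply: le_trans ll; rewrite -nth_last; apply: (leq_s') => //; rewrite ?inE ?prednK //.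
  by rewrite -ltnS prednK.
Qed.

(** If no break lies in the interval from [l] (excluded) to [m], both levels are isomorphic to the
    one at the last break up to [l]. Past the final break, they are compared with the colimit
    instead. *)
Lemma filtration_adapted W : is_filtration (W : fun_cat L A) -> exists s, adapted s W.
Proof.
move=> [M [Mm [s [s_lt s0 s1 s2 s3]]]]; exists s.
have Mm' l := strict_mono_monic ((strict_monic_strict_mono qA _).1 (Mm l)).
have W0 l : (forall b, b \in s -> l < b) -> is_zero (W l).
  case: s s0 s1 {s_lt s2 s3} => [|b s] s0 s1 sl.
    by apply: monic_to_zero (Mm' l) _; apply/s0.
  by apply: s1 => //=; apply: sl; exact: mem_head.
split=> // l m h; last first.
  apply: (strict_mono_cancel qA (g := colim_in M (isT : predT m))).
  by rewrite colim_cocone; apply/(strict_monic_strict_mono qA).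
move=> sl; have [sle|] := EM (forall b, b \in s -> l < b).
  by apply: zero_iso; apply: W0 => // b bs; exact: sl (sle b bs).
move=> nsl; have /dog_seq_max[b] : [seq b <- s | b <= l] <> [::].
  move=> s_l; apply: nsl => b bs; rewrite dog_ltNge; apply/negP => bl.
  have : b \in [seq b <- s | b <= l] by rewrite mem_filter bl.
  by rewrite s_l.
rewrite mem_filter => /andP[bl /(nthP 0)[i si sib]] bmax.
have bm := le_trans bl h.
have [Si|Si] := ltnP i.+1 (size s).
  have lSi : l < s`_i.+1.
    rewrite dog_ltNge; apply/negP => Sil.
    have : s`_i.+1 <= b by apply: bmax; rewrite mem_filter Sil mem_nth.
    by rewrite -sib (lt_sorted_leq_nth 0 s_lt) // ltnn.
  have mSi : m < s`_i.+1 by apply: sl lSi; exact: mem_nth.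
  rewrite -sib in bl bm.
  apply: (@is_iso_cancelr _ _ _ _ _ (dmap W bl)); first exact: s2.
  by rewrite (dmapM _ _ _ bm); exact: s2.
have Ei : last 0 s = b.
  by rewrite -sib -nth_last; congr nth; apply/eqP;
    rewrite -eqSS prednK ?eqn_leq ?Si ?(leq_ltn_trans _ si).
have s_gt0 : (0 < size s)%N by exact: leq_ltn_trans si.
apply: (@is_iso_cancel _ _ _ _ (colim_in M (isT : predT m))); first by apply: s3; rewrite // Ei.
by rewrite colim_cocone; apply: s3; rewrite // Ei.
Qed.

End Breaks.

(** * Graded pieces as cokernels between two levels *)

Section Graded.
Variables (L : divOrderedGroup) (A : quasiAbelianCat).
Implicit Types (X Y : WApre L A) (l m b c : L).
Let qA := qa_quasi_abelian A.

Lemma gr_proj_iso X l : (forall m, m < l -> is_zero (sval X m)) -> is_iso (gr_proj l X).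
Proof.
move=> X0; have h : W_lt_le X l = 0.
  by apply: colim_ext => m Pm; apply: zero_mor; exact: X0.
have [u ug] := @cokernel_desc _ _ _ _ _ _ _ (idm _) (gr_projP l X) (etrans (mcomp1m _) h).
exists u; split=> //; apply: (cokernel_epi (gr_projP l X)).
by rewrite -mcompA ug mcompm1 mcomp1m.
Qed.

(** As the filtration is constant from [b] up to [l], the morphism from [W_b] to [W_{<l}] is epi, so
    both have the same cokernel in [W_l]. *)
Lemma gr_proj_cokernel X l b (bl : b < l) :
  (forall m (h : b <= m), m < l -> is_iso (dmap (sval X) h)) ->
  is_cokernel (dmap (sval X) (ltW bl)) (gr_proj l X).
Proof.
move=> Xi; rewrite -(W_lt_leE X bl); apply: cokernel_epi_comp (gr_projP l X).
move=> T u v uv; apply: colim_ext => m Pm.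
have [bm|/ltW mb] := dog_le_or_lt b m.
  apply: (iso_epi (Xi m bm Pm)).
  by rewrite -!mcompA (@colim_cocone _ _ _ _ _ (W_lt X l) b m bl Pm bm).
rewrite -(@colim_cocone _ _ _ _ _ (W_lt X l) m b Pm bl mb) !mcompA.
by congr (_ ∘ _).
Qed.

Lemma gr_proj_short_exact X s l b (bl : b < l) : adapted s (sval X) ->
  (forall c, c \in s -> c < l -> c <= b) ->
  short_exact (dmap (sval X) (ltW bl)) (gr_proj l X).
Proof.
move=> aX sl; apply: short_exact_cokernel; first by case: aX.
by apply: gr_proj_cokernel; exact: adapted_below aX sl.
Qed.

End Graded.

Lemma kernel_transport (C : preadditive) (X Y K X' Y' K' : C) (f : Mor X Y)
    (k : Mor K X) (f' : Mor X' Y') (k' : Mor K' X') (a : Mor X X') (b : Mor Y Y')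
    (u : Mor K K') :
  is_kernel f k -> f' ∘ a = b ∘ f -> k' ∘ u = a ∘ k ->
  is_iso a -> is_monic b -> is_iso u -> is_kernel f' k'.
Proof.
move=> fk fa ku /is_iso_inv[a' [a1 a2 a'i]] bm /is_iso_inv[u' [u1 u2 u'i]].
have -> : k' = a ∘ (k ∘ u') by rewrite mcompA -ku -mcompA u2 mcompm1.
have ff' : b ∘ f ∘ a' = f' by rewrite -fa -mcompA a2 mcompm1.
have ku'P := kernel_monic_comp bm (kernel_iso u'i fk).
apply: kernelP.
- by rewrite -ff' -mcompA (mcompA a') a1 mcomp1m (kernel_comp0 ku'P).
- by apply: monic_comp (kernel_monic ku'P); apply: iso_monic; exists a'.
- move=> T t ft; have [|v vE] := kernel_lift (t := a' ∘ t) ku'P.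
    by rewrite mcompA ff'.
  by exists v; rewrite -mcompA vE mcompA a2 mcomp1m.
Qed.

Lemma cokernel_transport (C : preadditive) (X Y Q X' Y' Q' : C) (f : Mor X Y)
    (q : Mor Y Q) (f' : Mor X' Y') (q' : Mor Y' Q') (a : Mor X X') (b : Mor Y Y')
    (u : Mor Q Q') :
  is_cokernel f q -> f' ∘ a = b ∘ f -> q' ∘ b = u ∘ q ->
  is_epi a -> is_iso b -> is_iso u -> is_cokernel f' q'.
Proof.
move=> fq fa qb ae /is_iso_inv[b' [b1 b2 b'i]] /is_iso_inv[u' [u1 u2 u'i]].
apply: (cokernel_of_epi_comp ae); rewrite fa.
have -> : q' = u ∘ (q ∘ b') by rewrite mcompA -qb -mcompA b2 mcompm1.
apply: cokernelP.
- by rewrite -!mcompA (mcompA b') b1 mcomp1m (cokernel_comp0 fq) mcompm0.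
- apply: epi_comp; first by apply: iso_epi; exists u'.
  by apply: epi_comp (iso_epi b'i); exact: cokernel_epi fq.
- move=> T t; rewrite mcompA => /(cokernel_desc fq)[v vE]; exists (v ∘ u').
  by rewrite -mcompA (mcompA u') u1 mcomp1m mcompA vE -mcompA b2 mcompm1.
Qed.

(** * Strictness of the levels of a morphism *)
Section StrictFactor.
Variable A : quasiAbelianCat.
Let qA := qa_quasi_abelian A.

Lemma strict_factor_transport (X Y X' Y' : A) (f : Mor X Y) (f' : Mor X' Y')
    (a : Mor X X') (b : Mor Y Y') :
  strict_factor f -> f' ∘ a = b ∘ f -> is_iso a -> is_iso b -> strict_factor f'.
Proof.
move=> [I [e [m [es ms fE]]]] fa /is_iso_inv[a' [a1 a2 a'i]] bi.
exists I, (e ∘ a'), (b ∘ m); split.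
- by apply: (strict_epi_comp qA) => //; exact: strict_epi_iso.
- by apply: (strict_mono_comp qA) => //; exact: strict_mono_iso.
- by rewrite -!mcompA (mcompA m) fE mcompA -fa -mcompA a2 mcompm1.
Qed.

(** Stated for arbitrary choices, because in [WA] the coimage and the image are fixed globally
    before a level is examined. *)
Lemma strict_factor_iso (X Y K J C I : A) (f : Mor X Y) (k : Mor K X) (j : Mor X J)
    (c : Mor Y C) (i : Mor I Y) (u : Mor J I) :
  strict_factor f -> is_kernel f k -> is_cokernel k j -> is_cokernel f c ->
  is_kernel c i -> i ∘ u ∘ j = f -> is_iso u.
Proof.
move=> [H [e [m [es ms fE]]]] fk kj fc ci uE.
have ke : is_cokernel k e.
  apply: (strict_epi_cokernel es).
  by apply: (kernel_of_monic_comp (strict_mono_monic ms)); rewrite fE.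
have cm : is_kernel c m.
  apply: (strict_mono_kernel ms).
  by apply: (cokernel_of_epi_comp (strict_epi_epi es)); rewrite fE.
have [t ti tE] := cokernel_uniq kj ke.
have [r ri rE] := kernel_uniq ci cm.
suff -> : u = r ∘ t by exact: is_isoM.
apply: (kernel_monic ci); apply: (cokernel_epi kj).
by rewrite uE mcompA rE -mcompA tE.
Qed.

End StrictFactor.

(** * Levelwise kernels and cokernels of diagrams *)

Section DiagramKernels.
Variables (L : divOrderedGroup) (A : quasiAbelianCat).
Implicit Types F G K Q : diagram L A.
Let qA := qa_quasi_abelian A.

Lemma kernel_diagram F G (f : nat_trans F G) :
  exists K (k : nat_trans K F), forall l, is_kernel (f l) (k l).
Proof.
have ex l : exists Kk : {K : A & Mor K (F l)}, is_kernel (f l) (projT2 Kk).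
  by have [K [k kP]] := kernel_exists qA (f l); exists (existT _ K k).
pose K l := projT1 (sval (cid (ex l))).
pose k l : Mor (K l) (F l) := projT2 (sval (cid (ex l))).
have kP l : is_kernel (f l) (k l) by rewrite /k /K; case: cid.
have dex l m (h : l <= m) : exists d : Mor (K l) (K m), k m ∘ d = dmap F h ∘ k l.
  apply: (kernel_lift (kP m)).
  by rewrite mcompA ntP -mcompA (kernel_comp0 (kP l)) mcompm0.
pose d l m h := sval (cid (dex l m h)).
have dP l m h : k m ∘ d l m h = dmap F h ∘ k l by rewrite /d; case: cid.
have d1 l h : d l l h = idm _.
  by apply: (kernel_monic (kP l)); rewrite dP dmap1 mcomp1m mcompm1.
have dM l m n hlm hmn hln : d m n hmn ∘ d l m hlm = d l n hln.
  apply: (kernel_monic (kP n)).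
  by rewrite mcompA dP -mcompA dP mcompA (dmapM _ _ _ hln) dP.
exists (Diagram d1 dM), (@NatTrans _ _ _ (Diagram d1 dM) F k dP).
exact: kP.
Qed.

Lemma cokernel_diagram F G (f : nat_trans F G) :
  exists Q (q : nat_trans G Q), forall l, is_cokernel (f l) (q l).
Proof.
have ex l : exists Qq : {Q : A & Mor (G l) Q}, is_cokernel (f l) (projT2 Qq).
  by have [Q [q qP]] := cokernel_exists qA (f l); exists (existT _ Q q).
pose Q l := projT1 (sval (cid (ex l))).
pose q l : Mor (G l) (Q l) := projT2 (sval (cid (ex l))).
have qP l : is_cokernel (f l) (q l) by rewrite /q /Q; case: cid.
have dex l m (h : l <= m) : exists d : Mor (Q l) (Q m), d ∘ q l = q m ∘ dmap G h.
  apply: (cokernel_desc (qP l)).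
  by rewrite -mcompA -ntP mcompA (cokernel_comp0 (qP m)) mcomp0m.
pose d l m h := sval (cid (dex l m h)).
have dP l m h : d l m h ∘ q l = q m ∘ dmap G h by rewrite /d; case: cid.
have d1 l h : d l l h = idm _.
  by apply: (cokernel_epi (qP l)); rewrite dP dmap1 mcomp1m mcompm1.
have dM l m n hlm hmn hln : d m n hmn ∘ d l m hlm = d l n hln.
  apply: (cokernel_epi (qP l)).
  by rewrite -mcompA dP mcompA dP -mcompA (dmapM _ _ _ hln) dP.
exists (Diagram d1 dM), (@NatTrans _ _ _ G (Diagram d1 dM) q (fun l m h => esym (dP l m h))).
exact: qP.
Qed.

Lemma adapted_kernel s F G K (f : nat_trans F G) (k : nat_trans K F) :
  adapted s F -> adapted s G -> (forall l, is_kernel (f l) (k l)) -> adapted s K.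
Proof.
move=> [F0 Fi Fm] [G0 Gi Gm] kP; split=> [l sl|l m h sl|l m h].
- exact: monic_to_zero (kernel_monic (kP l)) (F0 l sl).
- apply: (kernel_map_iso (kP l) (kP m) (a := dmap F h) (b := dmap G h)).
  + by rewrite ntP.
  + by rewrite ntP.
  + exact: Fi.
  + exact: strict_mono_monic.
- apply: (strict_mono_cancel qA (g := k m)); rewrite ntP.
  by apply: (strict_mono_comp qA) => //; exists (G l), (f l).
Qed.

(** Unlike for kernels, strict monicity of the transition morphisms is not formal and is assumed
    here. [level_cokernel_mono] supplies it for slope filtrations. *)
Lemma adapted_cokernel s F G Q (f : nat_trans F G) (q : nat_trans G Q) :
  adapted s F -> adapted s G -> (forall l, is_cokernel (f l) (q l)) ->
  (forall l m (h : l <= m), strict_mono (dmap Q h)) -> adapted s Q.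
Proof.
move=> [F0 Fi Fm] [G0 Gi Gm] qP Qm; split=> // [l sl|l m h sl].
- exact: epi_from_zero (cokernel_epi (qP l)) (G0 l sl).
- apply: (cokernel_map_iso (qP l) (qP m) (a := dmap F h) (b := dmap G h)).
  + by rewrite ntP.
  + by rewrite ntP.
  + exact: Gi.
  + by apply: iso_epi; exact: Fi.
Qed.

End DiagramKernels.

(** The measure for inductions over levels: passing from [l] down to a break [b] loses at least [b]
    itself. *)
Lemma size_filter_lt (L : divOrderedGroup) (s : seq L) (b l : L) : b \in s -> b < l ->
  (size [seq c <- s | (c < b)%R] < size [seq c <- s | (c < l)%R])%N.
Proof.
move=> bs bl.
have -> : [seq c <- s | c < b] = [seq c <- [seq c <- s | c < l] | c < b].
  rewrite -filter_predI; apply: eq_filter => c /=.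
  by case cb: (c < b) => //=; rewrite (lt_trans cb bl).
set t := [seq c <- s | c < l]; rewrite size_filter -[ltnLHS]addn0.
rewrite -(count_predC (fun c => c < b) t) ltn_add2l -has_count.
by apply/hasP; exists b; rewrite /= ?ltxx // mem_filter bl.
Qed.

(** * Induction over the breaks with the snake lemma *)

Section Strictness.
Variables (A : quasiAbelianCat) (L : divOrderedGroup).
Variables (rk : A -> nat) (deg : A -> L).
Hypotheses (hrk : rank_function rk) (hdeg : degree_function deg)
  (hslope : slope_function rk deg).
Let qA := qa_quasi_abelian A.
Variables (X Y : WApre L A) (f : nat_trans (sval X) (sval Y)).
Hypotheses (pX : forall l, pure rk deg l (gr_ob l X))
  (pY : forall l, pure rk deg l (gr_ob l Y)).
Variable s : seq L.
Hypotheses (aX : adapted s (sval X)) (aY : adapted s (sval Y)).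

Let grf l : Mor (gr_ob l X) (gr_ob l Y) := @gr_map L A l X Y f.

Let grfE l : grf l ∘ gr_proj l X = gr_proj l Y ∘ f l.
Proof. exact: gr_mapE. Qed.

(** The second half stands in for the claim that the cokernel is an iterated extension of pure
    objects of slopes at most [l]. Only the vanishing of morphisms into it is ever used, and this
    property passes to extensions. *)
Lemma level_strict l : strict_factor (f l) /\
  forall l' (S Q : A) (q : Mor (sval Y l) Q) (d : Mor S Q),
    l < l' -> pure rk deg l' S -> is_cokernel (f l) q -> d = 0.
Proof.
have [n] := ubnP (size [seq b <- s | b < l]); elim: n l => // n IH l sn.
have [grs grK grQ] := pure_strict hrk hdeg hslope (grf l) (pX l) (pY l) erefl.
have [Q'' [q'' q''P]] := cokernel_exists qA (grf l).
(* Without breaks below [l], level [l] is its own graded piece, and both claims are those for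
   [grf l]. *)
have [sl|[b [bs bl bmax]]] := break_below s l.
  have Xi := gr_proj_iso (adapted_below0 aX sl).
  have Yi := gr_proj_iso (adapted_below0 aY sl).
  have [y [y1 y2 yi]] := is_iso_inv Yi.
  have [x [x1 x2 xi]] := is_iso_inv Xi.
  have fE : f l ∘ x = y ∘ grf l.
    by rewrite -[RHS]mcompm1 -x2 -!mcompA (mcompA (grf l)) grfE -mcompA mcompA y1 mcomp1m.
  split; first exact: strict_factor_transport grs fE xi yi.
  move=> l' S Q q d ll' pS qP.
  apply: (pure_hom0 hrk hdeg hslope d pS _ ll').
  have qy : is_cokernel (grf l) (q ∘ y).
    apply: (cokernel_transport qP (a := gr_proj l X) (b := gr_proj l Y) (u := idm Q)) => //.
    - by rewrite -mcompA y1 mcompm1 mcomp1m.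
    - exact: iso_epi.
    - exact: is_iso_id.
  exact: grQ qy.
have [|IHs IHh] := IH b; first exact: leq_trans (size_filter_lt bs bl) _.
have sX := gr_proj_short_exact bl aX bmax.
have sY := gr_proj_short_exact bl aY bmax.
have [K'' [k'' k''P]] := kernel_exists qA (grf l).
have [C' [c' c'P]] := cokernel_exists qA (f b).
have hom0 (d : Mor K'' C') : d = 0.
  exact: IHh bl (grK _ _ k''P) c'P.
have fi := ntP f (ltW bl).
have fs := snake_strict qA sX sY fi (esym (grfE l)) IHs grs k''P c'P hom0.
split=> // l' S Q q d ll' pS qP.
have [|jc jcE] := cokernel_desc (t := q ∘ dmap (sval Y) (ltW bl)) c'P.
  by rewrite -mcompA -fi mcompA (cokernel_comp0 qP) mcomp0m.
have [|qc qcE] := cokernel_desc (t := q'' ∘ gr_proj l Y) qP.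
  by rewrite -mcompA -grfE mcompA (cokernel_comp0 q''P) mcomp0m.
have se := snake_cokernel qA sX sY fi (esym (grfE l)) grs k''P c'P hom0 qP q''P jcE qcE.
(* The target [Q''] is pure of slope [l < l']. So [d] comes from a morphism into [C'], which
   vanishes by induction since [b < l < l']. *)
have qd : qc ∘ d = 0 by exact: (pure_hom0 hrk hdeg hslope _ pS (grQ _ _ q''P) ll').
have [d' <-] := kernel_lift se.1 qd.
by rewrite (IHh _ _ _ _ d' (lt_trans bl ll') pS c'P) mcompm0.
Qed.

Section Step.
Variables (b l : L).
Hypotheses (bl : b < l) (bmax : forall c, c \in s -> c < l -> c <= b).

Lemma level_kernel (K' K K'' : A) (k' : Mor K' (sval X b)) (k : Mor K (sval X l))
    (k'' : Mor K'' (gr_ob l X)) (ik : Mor K' K) (pk : Mor K K'') :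
  is_kernel (f b) k' -> is_kernel (f l) k -> is_kernel (grf l) k'' ->
  k ∘ ik = dmap (sval X) (ltW bl) ∘ k' -> k'' ∘ pk = gr_proj l X ∘ k ->
  short_exact ik pk.
Proof.
move=> k'P kP k''P ikE pkE.
have [C' [c' c'P]] := cokernel_exists qA (f b).
have [_ grK _] := pure_strict hrk hdeg hslope (grf l) (pX l) (pY l) erefl.
apply: (snake_kernel qA (gr_proj_short_exact bl aX bmax) (gr_proj_short_exact bl aY bmax)
  (ntP f (ltW bl)) (esym (grfE l)) (level_strict b).1 k'P kP k''P c'P _ ikE pkE) => d.
exact: (level_strict b).2 bl (grK _ _ k''P) c'P.
Qed.

Lemma level_cokernel (C' C C'' : A) (c' : Mor (sval Y b) C') (c : Mor (sval Y l) C)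
    (c'' : Mor (gr_ob l Y) C'') (jc : Mor C' C) (qc : Mor C C'') :
  is_cokernel (f b) c' -> is_cokernel (f l) c -> is_cokernel (grf l) c'' ->
  jc ∘ c' = c ∘ dmap (sval Y) (ltW bl) -> qc ∘ c = c'' ∘ gr_proj l Y ->
  short_exact jc qc.
Proof.
move=> c'P cP c''P jcE qcE.
have [K'' [k'' k''P]] := kernel_exists qA (grf l).
have [grs grK _] := pure_strict hrk hdeg hslope (grf l) (pX l) (pY l) erefl.
apply: (snake_cokernel qA (gr_proj_short_exact bl aX bmax)
  (gr_proj_short_exact bl aY bmax) (ntP f (ltW bl)) (esym (grfE l)) grs k''P c'P
  _ cP c''P jcE qcE) => d.
exact: (level_strict b).2 bl (grK _ _ k''P) c'P.
Qed.

End Step.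

(** Going down from [m] break by break, each map of cokernels is the left-hand map of a snake
    sequence, hence a kernel. Strict monics compose. *)
Lemma level_cokernel_mono l m (h : l <= m) (C C' : A) (c : Mor (sval Y l) C)
    (c' : Mor (sval Y m) C') (jc : Mor C C') :
  is_cokernel (f l) c -> is_cokernel (f m) c' -> jc ∘ c = c' ∘ dmap (sval Y) h ->
  strict_mono jc.
Proof.
have [n] := ubnP (size [seq b <- s | b < m]).
elim: n m h C' c' jc => // n IH m h C' c' jc sn cP c'P jcE.
have [ml|lm] := dog_le_or_lt m l.
  have lm : l = m by apply/le_anti; rewrite h ml.
  case: m / lm h c' jcE c'P {sn ml} => h c' jcE c'P.
  apply: strict_mono_iso; have [u ui uE] := cokernel_uniq cP c'P.
  suff -> : jc = u by [].
  by apply: (cokernel_epi cP); rewrite jcE uE dmap1 mcompm1.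
have step b (bm : b < m) : l <= b -> (forall c, c \in s -> c < m -> c <= b) ->
    forall (Cb : A) (cb : Mor (sval Y b) Cb) (jb : Mor Cb C'), is_cokernel (f b) cb ->
    jb ∘ cb = c' ∘ dmap (sval Y) (ltW bm) -> strict_mono jb.
  move=> lb bmax Cb cb jb cbP jbE.
  have [C'' [c'' c''P]] := cokernel_exists qA (grf m).
  have [|qc qcE] := cokernel_desc (t := c'' ∘ gr_proj m Y) c'P.
    by rewrite -mcompA -grfE mcompA (cokernel_comp0 c''P) mcomp0m.
  by exists C'', qc; case: (level_cokernel bmax cbP c'P c''P jbE qcE).
have dl (b : L) (lb : l <= b) (bm : b < m) : dmap (sval Y) h =
    dmap (sval Y) (ltW bm) ∘ dmap (sval Y) lb by rewrite (dmapM _ _ _ h).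
(* When all breaks below [m] are at most [l], level [l] takes the place of the last break, whether
   or not [l] is a break. *)
have here : (forall c, c \in s -> c < m -> c <= l) -> strict_mono jc.
  move=> lmax; apply: (step l lm (lexx l) lmax _ c) => //.
  by rewrite jcE (dmap_irr _ h (ltW lm)).
have [sm|[b [bs bm bmax]]] := break_below s m.
  by apply: here => x /sm mx /(le_lt_trans mx); rewrite ltxx.
have [bl|/ltW lb] := dog_le_or_lt b l.
  by apply: here => x xs xm; exact: le_trans (bmax x xs xm) bl.
have [Cb [cb cbP]] := cokernel_exists qA (f b).
have [|j1 j1E] := cokernel_desc (t := cb ∘ dmap (sval Y) lb) cP.
  by rewrite -mcompA -ntP mcompA (cokernel_comp0 cbP) mcomp0m.
have [|j2 j2E] := cokernel_desc (t := c' ∘ dmap (sval Y) (ltW bm)) cbP.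
  by rewrite -mcompA -ntP mcompA (cokernel_comp0 c'P) mcomp0m.
have -> : jc = j2 ∘ j1.
  apply: (cokernel_epi cP).
  by rewrite jcE (dl b lb bm) -mcompA j1E !mcompA j2E.
apply: (strict_mono_comp qA).
  exact: (step b bm lb bmax _ cb _ cbP j2E).
by apply: (IH b lb _ cb) => //; exact: leq_trans (size_filter_lt bs bm) _.
Qed.

(** The graded piece of the kernel filtration and the kernel of [grf l] are both cokernels of the
    same inclusion of kernels, the latter by the snake sequence. Without breaks below [l], the claim
    is transported along the isomorphisms [gr_proj]. *)
Lemma gr_kernel l (K : WApre L A) (k : nat_trans (sval K) (sval X)) :
  (forall m, is_kernel (f m) (k m)) ->
  is_kernel (grf l) (@gr_map L A l K X k).
Proof.
move=> kP; have aK := adapted_kernel aX aY kP.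
have gkE := @gr_mapE L A l K X k.
have [sl|[b [bs bl bmax]]] := break_below s l.
  apply: (kernel_transport (kP l) (grfE l) gkE).
  - exact: gr_proj_iso (adapted_below0 aX sl).
  - exact: iso_monic (gr_proj_iso (adapted_below0 aY sl)).
  - exact: gr_proj_iso (adapted_below0 aK sl).
have [K'' [k'' k''P]] := kernel_exists qA (grf l).
have [|pk pkE] := kernel_lift (t := gr_proj l X ∘ k l) k''P.
  by rewrite mcompA grfE -mcompA (kernel_comp0 (kP l)) mcompm0.
have se := level_kernel bmax (kP b) (kP l) k''P (ntP k (ltW bl)) pkE.
have [u ui uE] := cokernel_uniq (gr_proj_short_exact bl aK bmax).2 se.2.
suff -> : @gr_map L A l K X k = k'' ∘ u by exact: kernel_iso.
by apply: gr_projI; rewrite -mcompA uE pkE.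
Qed.

Lemma adapted_cokernel_pure (Q : diagram L A) (q : nat_trans (sval Y) Q) :
  (forall m, is_cokernel (f m) (q m)) -> adapted s Q.
Proof.
move=> qP; apply: (adapted_cokernel aX aY qP) => m n h.
exact: level_cokernel_mono (qP m) (qP n) (esym (ntP q h)).
Qed.

Lemma gr_cokernel l (Q : WApre L A) (q : nat_trans (sval Y) (sval Q)) :
  (forall m, is_cokernel (f m) (q m)) ->
  is_cokernel (grf l) (@gr_map L A l Y Q q).
Proof.
move=> qP; have gqE := @gr_mapE L A l Y Q q.
have aQ := adapted_cokernel_pure qP.
have [sl|[b [bs bl bmax]]] := break_below s l.
  apply: (cokernel_transport (qP l) (grfE l) gqE).
  - exact: iso_epi (gr_proj_iso (adapted_below0 aX sl)).
  - exact: gr_proj_iso (adapted_below0 aY sl).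
  - exact: gr_proj_iso (adapted_below0 aQ sl).
have [C'' [c'' c''P]] := cokernel_exists qA (grf l).
have [|qc qcE] := cokernel_desc (t := c'' ∘ gr_proj l Y) (qP l).
  by rewrite -mcompA -grfE mcompA (cokernel_comp0 c''P) mcomp0m.
have se := level_cokernel bmax (qP b) (qP l) c''P (esym (ntP q (ltW bl))) qcE.
have [u ui uE] := cokernel_uniq se.2 (gr_proj_short_exact bl aQ bmax).2.
suff -> : @gr_map L A l Y Q q = u ∘ c'' by exact: cokernel_iso.
by apply: gr_projI; rewrite gqE -uE -!mcompA qcE.
Qed.

End Strictness.

(** * Strict compatibility and co-compatibility on colimits *)

Section Compatibility.
Variables (A : quasiAbelianCat) (L : divOrderedGroup).
Variables (rk : A -> nat) (deg : A -> L).
Hypotheses (hrk : rank_function rk) (hdeg : degree_function deg)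
  (hslope : slope_function rk deg).
Let qA := qa_quasi_abelian A.
Variables (X Y : WApre L A) (f : nat_trans (sval X) (sval Y)).
Hypotheses (pX : forall l, pure rk deg l (gr_ob l X))
  (pY : forall l, pure rk deg l (gr_ob l Y)).
Variable s : seq L.
Hypotheses (aX : adapted s (sval X)) (aY : adapted s (sval Y)).

Let ft : Mor (total_ob X) (total_ob Y) := @total_map L A X Y f.

Lemma total_mapE l : ft ∘ W_in X l = W_in Y l ∘ f l.
Proof. exact: colim_mapE. Qed.

Lemma W_in_strict_mono (Z : WApre L A) l : strict_mono (W_in Z l).
Proof. by apply/(strict_monic_strict_mono qA); case: (totalP Z). Qed.

Lemma W_in_iso (Z : WApre L A) l :
  adapted s (sval Z) -> (forall b, b \in s -> b <= l) -> is_iso (W_in Z l).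
Proof. by move=> aZ sl; apply: colim_in_iso; exact: adapted_above aZ sl. Qed.

Lemma total_strict : strict_factor ft.
Proof.
have [l0 sl0] := seq_bound s.
have [fs _] := level_strict hrk hdeg hslope f pX pY aX aY l0.
by apply: (strict_factor_transport fs (total_mapE l0)); exact: W_in_iso.
Qed.

Lemma total_cokernel_mono l (C C' : A) (c : Mor (sval Y l) C)
    (c' : Mor (total_ob Y) C') (jc : Mor C C') :
  is_cokernel (f l) c -> is_cokernel ft c' -> jc ∘ c = c' ∘ W_in Y l ->
  strict_mono jc.
Proof.
move=> cP c'P jcE; have [l0 sl0] := seq_bound s.
(* At a level [l1] past all breaks the filtrations equal their colimits, so the claim reduces to two
   levels. *)
have [l1 ll1 sl1] : exists2 l1, l <= l1 & forall b, b \in s -> b <= l1.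
  have [ll0|/ltW l0l] := dog_le_or_lt l l0; first by exists l0.
  by exists l => // b /sl0 bl; exact: le_trans bl l0l.
have [C1 [c1 c1P]] := cokernel_exists qA (f l1).
have [|j1 j1E] := cokernel_desc (t := c1 ∘ dmap (sval Y) ll1) cP.
  by rewrite -mcompA -ntP mcompA (cokernel_comp0 c1P) mcomp0m.
have [|j2 j2E] := cokernel_desc (t := c' ∘ W_in Y l1) c1P.
  by rewrite -mcompA -total_mapE mcompA (cokernel_comp0 c'P) mcomp0m.
have -> : jc = j2 ∘ j1.
  apply: (cokernel_epi cP); rewrite jcE -mcompA j1E mcompA j2E -mcompA.
  by congr (_ ∘ _); apply/esym; exact: colim_cocone.
apply: (strict_mono_comp qA).
  apply/strict_mono_iso/(cokernel_map_iso c1P c'P (esym (total_mapE l1)) j2E).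
    exact: W_in_iso.
  by apply: iso_epi; exact: W_in_iso.
exact: (level_cokernel_mono hrk hdeg hslope pX pY aX aY cP c1P j1E).
Qed.

(** The common core of both compatibilities: an element of [W_l N] that dies in the total cokernel
    already dies in the cokernel at level [l], which embeds into it. *)
Lemma total_lift_image l (T I : A) (m : Mor I (sval Y l)) (y : Mor T (sval Y l))
    (x : A) (c : Mor (total_ob Y) x) :
  is_cokernel ft c -> strict_mono m -> (exists2 e, strict_epi e & m ∘ e = f l) ->
  c ∘ (W_in Y l ∘ y) = 0 -> exists v, m ∘ v = y.
Proof.
move=> cP ms [e es mE] cy.
have [C1 [c1 c1P]] := cokernel_exists qA (f l).
have [|j jE] := cokernel_desc (t := c ∘ W_in Y l) c1P.
  by rewrite -mcompA -total_mapE mcompA (cokernel_comp0 cP) mcomp0m.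
apply: (kernel_lift (f := c1)).
  apply: (strict_mono_kernel ms).
  by apply: (cokernel_of_epi_comp (strict_epi_epi es)); rewrite mE.
apply: (monic0 (strict_mono_monic (total_cokernel_mono c1P cP jE))).
by rewrite mcompA jE -mcompA.
Qed.

Lemma pure_strictly_compatible : @strictly_compatible L A X Y f.
Proof.
move=> l; have [Il [el [ml [els mls flE]]]] := (level_strict hrk hdeg hslope f pX pY aX aY l).1.
have [I [e [m [es ms ftE]]]] := total_strict.
have [C [c cP]] := cokernel_exists qA ft.
have cm : is_kernel c m.
  apply: (strict_mono_kernel ms).
  by apply: (cokernel_of_epi_comp (strict_epi_epi es)); rewrite ftE.
have [|p pE] := kernel_lift (t := W_in Y l ∘ ml) cm.
  apply: (epi0 (strict_epi_epi els)).
  by rewrite -!mcompA flE -total_mapE mcompA (cokernel_comp0 cP) mcomp0m.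
have Wm := strict_mono_monic (W_in_strict_mono Y l).
(* The image at level [l] is itself shown to be the intersection, so the comparison morphism is an
   identity. *)
exists Il, (W_in Y l ∘ ml), I, m, Il, (W_in Y l ∘ ml), (idm Il); split.
- apply: (strict_factor_image qA (strict_epi_epi els)).
    by apply: (strict_mono_comp qA) => //; exact: W_in_strict_mono.
  by rewrite -mcompA flE -total_mapE.
- exact: (strict_factor_image qA (strict_epi_epi es) ms ftE).
- exists p, ml; split; last by rewrite pE.
  split=> // T a b ab.
  have [|v vE] := total_lift_image (y := b) cP mls (ex_intro2 _ _ el els flE).
    by rewrite -ab mcompA (kernel_comp0 cm) mcomp0m.
  exists v; split.
    split=> //; apply: (kernel_monic cm).
    by rewrite mcompA pE -mcompA vE ab.
  by move=> w [_ wE]; apply: (strict_mono_monic mls); rewrite vE wE.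
- by rewrite mcompm1.
- exact: is_iso_id.
Qed.

Lemma pure_strictly_cocompatible : @strictly_cocompatible L A X Y f.
Proof.
move=> l; have [Il [el [ml [els mls flE]]]] := (level_strict hrk hdeg hslope f pX pY aX aY l).1.
have [C [c cP]] := cokernel_exists qA ft.
have [K [k kP]] := kernel_exists qA ft.
have [R [r [q rq]]] := pullback_exists qA ft (W_in Y l).
have rs := pullback_strict_mono rq (W_in_strict_mono Y l).
have [frq rU] := rq.
have [|kR [[kRE _] _]] := rU K k 0; first by rewrite (kernel_comp0 kP) mcompm0.
have [R' [qR qRP]] := cokernel_exists qA kR.
have [D [i1 [i2 [p1 [p2 bip]]]]] := biproduct_exists qA (sval X l) K.
(* Likewise, the preimage [R] is itself shown to be the sum of [W_l M] and the kernel. *)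
exists K, k, R, r, kR, R, r, kR, (idm R), R', qR, R', qR, (idm R'); split=> //.
- exists D, i1, i2, p1, p2; split=> //.
  have [h1 h2 h3 h4 h5] := bip.
  have [|h [[hE _] _]] := rU D (W_in X l ∘ p1 + k ∘ p2) (f l ∘ p1).
    by rewrite mcompDr !mcompA (kernel_comp0 kP) mcomp0m addr0 total_mapE.
  apply: (strict_factor_image qA _ rs hE); apply: strict_epi_epi.
  have [|y yE] := total_lift_image (y := q) cP mls (ex_intro2 _ _ el els flE).
    by rewrite -frq mcompA (cokernel_comp0 cP) mcomp0m.
  have [T [e [x [es ex]]]] := strict_epi_lift qA y els.
  (* Up to a cover, an element of [R] has the same image in [N] as some [x] in [W_l M]. Their
     difference [z] lies in the kernel, so the element comes from the direct sum. *)
  have [|z kz] := kernel_lift (t := r ∘ e - W_in X l ∘ x) kP.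
    rewrite mcompBr !mcompA total_mapE frq -!mcompA -flE -mcompA ex.
    by rewrite (mcompA ml) yE subrr.
  suff hx : h ∘ (i1 ∘ x + i2 ∘ z) = e.
    by apply: (strict_epi_cancel qA (f := i1 ∘ x + i2 ∘ z)); rewrite hx.
  apply: (strict_mono_monic rs); rewrite mcompA hE mcompDl.
  rewrite -!mcompA !mcompDr !(mcompA p1) !(mcompA p2) h1 h2 h3 h4.
  by rewrite !mcomp1m !mcomp0m !mcompm0 addr0 add0r kz addrC subrK.
- by exists q.
- by split=> //; rewrite mcompm1.
- split=> //; first by rewrite mcomp1m mcompm1.
  exact: is_iso_id.
Qed.

End Compatibility.

(** * Exactness of functors, functor categories and full subcategories *)

Section Transfer.
Variables (C D : preadditive).

Lemma fmap_iso (F : functor C D) (X Y : C) (f : Mor X Y) :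
  is_iso f -> is_iso (fmap F f).
Proof. by move=> [g [gf fg]]; exists (fmap F g); rewrite -!fmapM gf fg !fmap1. Qed.

(** One preserved kernel and cokernel per morphism suffice: all others differ by isomorphisms, which
    [F] respects. *)
Lemma strongly_exactP (F : functor C D) :
  (forall (X Y : C) (f : Mor X Y), exists K (k : Mor K X),
     is_kernel f k /\ is_kernel (fmap F f) (fmap F k)) ->
  (forall (X Y : C) (f : Mor X Y), exists Q (q : Mor Y Q),
     is_cokernel f q /\ is_cokernel (fmap F f) (fmap F q)) ->
  strongly_exact F.
Proof.
move=> Fk Fc; split=> [X Y K f k kP|X Y Q f q qP].
  have [K0 [k0 [k0P Fk0]]] := Fk _ _ f.
  have [i ii <-] := kernel_uniq k0P kP.
  by rewrite fmapM; apply: kernel_iso Fk0; exact: fmap_iso.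
have [Q0 [q0 [q0P Fq0]]] := Fc _ _ f.
have [i ii <-] := cokernel_uniq q0P qP.
by rewrite fmapM; apply: cokernel_iso Fq0; exact: fmap_iso.
Qed.

End Transfer.

Section FunctorCategoryExactness.
Variables (L : divOrderedGroup) (A : quasiAbelianCat).
Implicit Types F G H K Q : fun_cat L A.

Lemma nat_kernel F G K (f : Mor F G) (k : Mor K F) :
  (forall l, is_kernel ((f : nat_trans F G) l) ((k : nat_trans K F) l)) -> is_kernel f k.
Proof.
move=> kP; apply: kernelP.
- by apply: nat_trans_eq => l; exact: kernel_comp0 (kP l).
- move=> H u v uv; apply: nat_trans_eq => l; apply: (kernel_monic (kP l)).
  exact: (congr1 (fun t : nat_trans H F => t l) uv).
- move=> H t ft; pose t' : nat_trans H F := t.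
  have ex l : exists u, (k : nat_trans K F) l ∘ u = t' l.
    apply: (kernel_lift (kP l)).
    exact: (congr1 (fun t : nat_trans H G => t l) ft).
  pose u l := sval (cid (ex l)).
  have uP l : (k : nat_trans K F) l ∘ u l = t' l by rewrite /u; case: cid.
  unshelve eexists (@NatTrans _ _ _ H K u _); last exact: nat_trans_eq.
  move=> l m h; apply: (kernel_monic (kP m)).
  by rewrite mcompA uP ntP (mcompA _ (dmap K h)) ntP -mcompA uP.
Qed.

Lemma nat_cokernel F G Q (f : Mor F G) (q : Mor G Q) :
  (forall l, is_cokernel ((f : nat_trans F G) l) ((q : nat_trans G Q) l)) -> is_cokernel f q.
Proof.
move=> qP; apply: cokernelP.
- by apply: nat_trans_eq => l; exact: cokernel_comp0 (qP l).
- move=> H u v uv; apply: nat_trans_eq => l; apply: (cokernel_epi (qP l)).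
  exact: (congr1 (fun t : nat_trans G H => t l) uv).
- move=> H t tf; pose t' : nat_trans G H := t.
  have ex l : exists u, u ∘ (q : nat_trans G Q) l = t' l.
    apply: (cokernel_desc (qP l)).
    exact: (congr1 (fun t : nat_trans F H => t l) tf).
  pose u l := sval (cid (ex l)).
  have uP l : u l ∘ (q : nat_trans G Q) l = t' l by rewrite /u; case: cid.
  unshelve eexists (@NatTrans _ _ _ Q H u _); last exact: nat_trans_eq.
  move=> l m h; apply: (cokernel_epi (qP l)).
  by rewrite -mcompA -ntP mcompA uP ntP -mcompA uP.
Qed.

Lemma nat_iso F G (f : Mor F G) :
  (forall l, is_iso ((f : nat_trans F G) l)) -> is_iso f.
Proof.
move=> fi; pose g l := sval (cid (fi l)).
have gP l : g l ∘ (f : nat_trans F G) l = idm _ /\ (f : nat_trans F G) l ∘ g l = idm _.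
  by rewrite /g; case: cid.
have gN l m h : g m ∘ dmap G h = dmap F h ∘ g l.
  apply: (iso_monic (fi m)); rewrite !mcompA (gP m).2 mcomp1m.
  by rewrite ntP -mcompA (gP l).2 mcompm1.
by exists (@NatTrans _ _ _ G F g gN); split; apply: nat_trans_eq => l; case: (gP l).
Qed.

End FunctorCategoryExactness.

Section FullSub.
Variables (C : preadditive) (P : C -> Prop).
Implicit Types X Y : full_sub P.

Lemma full_sub_kernel X Y K (f : Mor X Y) (k : Mor K X) :
  @is_kernel C (sval X) (sval Y) f (sval K) k -> is_kernel f k.
Proof. by move=> [fk kU]; split=> // T t; exact: kU. Qed.

Lemma full_sub_cokernel X Y Q (f : Mor X Y) (q : Mor Y Q) :
  @is_cokernel C (sval X) (sval Y) f (sval Q) q -> is_cokernel f q.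
Proof. by move=> [fk kU]; split=> // T t; exact: kU. Qed.

Lemma full_sub_iso X Y (f : Mor X Y) :
  @is_iso C (sval X) (sval Y) f -> is_iso f.
Proof. by move=> [g gP]; exists g. Qed.

End FullSub.

(** * The category of slope filtrations *)
Section Biproducts.
Variable C : preadditive.

Lemma biproduct_ext (X Y S T : C) (i1 : Mor X S) (i2 : Mor Y S) (p1 : Mor S X)
    (p2 : Mor S Y) (u v : Mor T S) :
  is_biproduct i1 i2 p1 p2 -> p1 ∘ u = p1 ∘ v -> p2 ∘ u = p2 ∘ v -> u = v.
Proof.
move=> [_ _ _ _ iE] uv1 uv2.
by rewrite -[u]mcomp1m -[v]mcomp1m -iE !mcompDl -!mcompA uv1 uv2.
Qed.

Lemma biproduct_zero (X Y S : C) (i1 : Mor X S) (i2 : Mor Y S) (p1 : Mor S X)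
    (p2 : Mor S Y) : is_biproduct i1 i2 p1 p2 -> is_zero X -> is_zero Y -> is_zero S.
Proof.
move=> bip X0 Y0; apply: is_zero_id.
by apply: (biproduct_ext bip); exact: mor_zero.
Qed.

Lemma biproduct_short_exact (X Y S : C) (i1 : Mor X S) (i2 : Mor Y S) (p1 : Mor S X)
    (p2 : Mor S Y) : is_biproduct i1 i2 p1 p2 -> short_exact i1 p2.
Proof.
move=> bip; have [h1 h2 h3 h4 h5] := bip; split.
  apply: kernelP => //.
    by apply: (@monic_cancel _ _ _ _ p1); rewrite h1; apply/iso_monic/is_iso_id.
  move=> T t pt; exists (p1 ∘ t); apply: (biproduct_ext bip).
    by rewrite !mcompA h1 mcomp1m.
  by rewrite !mcompA h4 !mcomp0m.
apply: cokernelP => //.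
  by apply: (@epi_cancel _ _ _ _ _ i2); rewrite h2; apply/iso_epi/is_iso_id.
move=> T t ti; exists (t ∘ i2).
by rewrite -[RHS]mcompm1 -h5 mcompDr !mcompA ti mcomp0m add0r.
Qed.

Section BiproductMap.
Variables (X Y S X' Y' S' : C).
Variables (i1 : Mor X S) (i2 : Mor Y S) (p1 : Mor S X) (p2 : Mor S Y).
Variables (i1' : Mor X' S') (i2' : Mor Y' S') (p1' : Mor S' X') (p2' : Mor S' Y').
Hypotheses (bip : is_biproduct i1 i2 p1 p2) (bip' : is_biproduct i1' i2' p1' p2').
Variables (a : Mor X X') (b : Mor Y Y') (d : Mor S S').
Hypotheses (p1d : p1' ∘ d = a ∘ p1) (p2d : p2' ∘ d = b ∘ p2).

Lemma biproduct_map_iso : is_iso a -> is_iso b -> is_iso d.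
Proof.
move=> [a' [a1 a2]] [b' [b1 b2]].
have [h1 h2 h3 h4 h5] := bip; have [h1' h2' h3' h4' h5'] := bip'.
have e1 : p1 ∘ (i1 ∘ a' ∘ p1' + i2 ∘ b' ∘ p2') = a' ∘ p1'.
  by rewrite mcompDr !mcompA h1 h3 mcomp1m !mcomp0m addr0.
have e2 : p2 ∘ (i1 ∘ a' ∘ p1' + i2 ∘ b' ∘ p2') = b' ∘ p2'.
  by rewrite mcompDr !mcompA h2 h4 mcomp1m !mcomp0m add0r.
exists (i1 ∘ a' ∘ p1' + i2 ∘ b' ∘ p2'); split.
  apply: (biproduct_ext bip); rewrite mcompA ?e1 ?e2 mcompm1 -mcompA.
    by rewrite p1d mcompA a1 mcomp1m.
  by rewrite p2d mcompA b1 mcomp1m.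
apply: (biproduct_ext bip'); rewrite mcompA mcompm1 ?p1d ?p2d -mcompA.
  by rewrite e1 mcompA a2 mcomp1m.
by rewrite e2 mcompA b2 mcomp1m.
Qed.

(** Makes the transition morphisms of a direct sum of filtrations strict monics. *)
Lemma biproduct_map_kernel (W1 W2 W : C) (j1 : Mor W1 W) (j2 : Mor W2 W)
    (q1 : Mor W W1) (q2 : Mor W W2) (g1 : Mor X' W1) (g2 : Mor Y' W2) :
  is_biproduct j1 j2 q1 q2 -> is_kernel g1 a -> is_kernel g2 b ->
  is_kernel (j1 ∘ g1 ∘ p1' + j2 ∘ g2 ∘ p2') d.
Proof.
move=> bipW ag bg; have [h1 h2 h3 h4 h5] := bip; have [w1 w2 w3 w4 w5] := bipW.
apply: kernelP.
- rewrite mcompDl -!mcompA p1d p2d (mcompA g1) (mcompA g2).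
  by rewrite (kernel_comp0 ag) (kernel_comp0 bg) !mcomp0m !mcompm0 addr0.
- apply: is_monicP => T z dz; apply: (biproduct_ext bip); rewrite mcompm0.
    by apply: (monic0 (kernel_monic ag)); rewrite mcompA -p1d -mcompA dz mcompm0.
  by apply: (monic0 (kernel_monic bg)); rewrite mcompA -p2d -mcompA dz mcompm0.
- move=> T t gt.
  have [|u uE] := kernel_lift (t := p1' ∘ t) ag.
    move/(congr1 (mcomp q1)): gt.
    by rewrite mcompm0 mcompDl mcompDr !mcompA w1 w3 !mcomp0m mcomp1m addr0.
  have [|v vE] := kernel_lift (t := p2' ∘ t) bg.
    move/(congr1 (mcomp q2)): gt.
    by rewrite mcompm0 mcompDl mcompDr !mcompA w2 w4 !mcomp0m mcomp1m add0r.
  exists (i1 ∘ u + i2 ∘ v); apply: (biproduct_ext bip').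
    by rewrite mcompA p1d -mcompA mcompDr !mcompA h1 h3 mcomp1m mcomp0m addr0.
  by rewrite mcompA p2d -mcompA mcompDr !mcompA h2 h4 mcomp1m mcomp0m add0r.
Qed.

End BiproductMap.
End Biproducts.

Section BiproductDiagram.
Variables (L : divOrderedGroup) (A : quasiAbelianCat).
Let qA := qa_quasi_abelian A.

Lemma biproduct_diagram (F G : fun_cat L A) : exists (S : fun_cat L A)
    (i1 : Mor F S) (i2 : Mor G S) (p1 : Mor S F) (p2 : Mor S G),
  is_biproduct i1 i2 p1 p2 /\
  forall s, adapted s F -> adapted s G -> adapted s S.
Proof.
have ex l : exists S : {S : A & Mor (F l) S * Mor (G l) S * Mor S (F l) * Mor S (G l)}%type,
    let: (i1, i2, p1, p2) := projT2 S in is_biproduct i1 i2 p1 p2.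
  have [S [i1 [i2 [p1 [p2 h]]]]] := biproduct_exists qA (F l) (G l).
  by exists (existT _ S (i1, i2, p1, p2)).
pose S l := projT1 (sval (cid (ex l))).
pose i1 l : Mor (F l) (S l) := (projT2 (sval (cid (ex l)))).1.1.1.
pose i2 l : Mor (G l) (S l) := (projT2 (sval (cid (ex l)))).1.1.2.
pose p1 l : Mor (S l) (F l) := (projT2 (sval (cid (ex l)))).1.2.
pose p2 l : Mor (S l) (G l) := (projT2 (sval (cid (ex l)))).2.
have bip l : is_biproduct (i1 l) (i2 l) (p1 l) (p2 l).
  rewrite /i1 /i2 /p1 /p2 /S; case: (cid (ex l)) => /= S'.
  by case: (projT2 S') => [[[? ?] ?] ?].
pose d l m (h : l <= m) := i1 m ∘ dmap F h ∘ p1 l + i2 m ∘ dmap G h ∘ p2 l.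
have p1d l m h : p1 m ∘ d l m h = dmap F h ∘ p1 l.
  have [h1 h2 h3 h4 h5] := bip m.
  by rewrite mcompDr !mcompA h1 h3 mcomp1m !mcomp0m addr0.
have p2d l m h : p2 m ∘ d l m h = dmap G h ∘ p2 l.
  have [h1 h2 h3 h4 h5] := bip m.
  by rewrite mcompDr !mcompA h2 h4 mcomp1m !mcomp0m add0r.
have di1 l m h : i1 m ∘ dmap F h = d l m h ∘ i1 l.
  have [h1 h2 h3 h4 h5] := bip l.
  by rewrite mcompDl -!mcompA h1 h4 mcompm1 !mcompm0 addr0.
have di2 l m h : i2 m ∘ dmap G h = d l m h ∘ i2 l.
  have [h1 h2 h3 h4 h5] := bip l.
  by rewrite mcompDl -!mcompA h2 h3 mcompm1 !mcompm0 add0r.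
have d1 l h : d l l h = idm _.
  by apply: (biproduct_ext (bip l)); rewrite ?p1d ?p2d dmap1 mcomp1m mcompm1.
have dM l m n hlm hmn hln : d m n hmn ∘ d l m hlm = d l n hln.
  apply: (biproduct_ext (bip n)); rewrite mcompA ?p1d ?p2d -mcompA ?p1d ?p2d mcompA.
    by rewrite (dmapM _ _ _ hln).
  by rewrite (dmapM _ _ _ hln).
pose SD := Diagram d1 dM.
exists SD, (@NatTrans _ _ _ F SD i1 di1), (@NatTrans _ _ _ G SD i2 di2),
  (@NatTrans _ _ _ SD F p1 p1d), (@NatTrans _ _ _ SD G p2 p2d); split.
  by split; apply: nat_trans_eq => l; case: (bip l).
move=> s [F0 Fi Fm] [G0 Gi Gm]; split=> [l sl|l m h sl|l m h].
- by apply: (biproduct_zero (bip l)); [exact: F0 | exact: G0].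
- by apply: (biproduct_map_iso (bip l) (bip m) (p1d l m h) (p2d l m h));
    [exact: Fi | exact: Gi].
- have [W1 [g1 g1P]] := Fm l m h; have [W2 [g2 g2P]] := Gm l m h.
  have [W [j1 [j2 [q1 [q2 bipW]]]]] := biproduct_exists qA W1 W2.
  exists W, (j1 ∘ g1 ∘ p1 m + j2 ∘ g2 ∘ p2 m).
  exact: (biproduct_map_kernel (bip l) (bip m) (p1d l m h) (p2d l m h) bipW g1P g2P).
Qed.

Lemma zero_diagram : exists2 Z : fun_cat L A, is_zero Z & adapted [::] Z.
Proof.
have [[[Z Z0] _] _ _ _ _] := qA.
pose D := @Diagram _ L A (fun=> Z) (fun _ _ _ => idm Z) (fun _ _ => erefl)
  (fun _ _ _ _ _ _ => mcomp1m _).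
exists D.
  by move=> F u v; split; apply: nat_trans_eq => l;
    [exact: (zero_mor _ _ Z0) | exact: (mor_zero _ _ Z0)].
by split=> // *; [exact: is_iso_id | exact/strict_mono_iso/is_iso_id].
Qed.

Lemma gr_biproduct l (X Y S : WApre L A) (i1 : Mor X S) (i2 : Mor Y S)
    (p1 : Mor S X) (p2 : Mor S Y) :
  is_biproduct i1 i2 p1 p2 ->
  is_biproduct (gr_map l i1) (gr_map l i2) (gr_map l p1) (gr_map l p2).
Proof.
have grD (X' Y' : WApre L A) (f g : Mor X' Y') : gr_map l (f + g) = gr_map l f + gr_map l g.
  by apply: gr_projI; rewrite mcompDl !gr_mapE -mcompDr.
have gr0 (X' Y' : WApre L A) : gr_map l (0 : Mor X' Y') = 0.
  by apply: gr_projI; rewrite gr_mapE mcomp0m -[RHS](mcompm0 _ (gr_proj l Y')).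
have grM (X' Y' Z' : WApre L A) (g : Mor Y' Z') (f : Mor X' Y') :
    gr_map l g ∘ gr_map l f = gr_map l (g ∘ f) := esym (fmapM (gr A l) g f).
have gr1 (X' : WApre L A) : gr_map l (idm X') = idm _ := fmap1 (gr A l) X'.
by move=> [h1 h2 h3 h4 h5]; split; rewrite !grM -?grD ?h1 ?h2 ?h3 ?h4 ?h5 ?gr1 ?gr0.
Qed.

End BiproductDiagram.

(** * Kernels, cokernels and abelianness of [WA] *)

Section SlopeFiltrations.
Variables (A : quasiAbelianCat) (L : divOrderedGroup).
Variables (rk : A -> nat) (deg : A -> L).
Hypotheses (hrk : rank_function rk) (hdeg : degree_function deg)
  (hslope : slope_function rk deg).
Let qA := qa_quasi_abelian A.
Local Notation WA := (WA rk deg).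
Local Notation level l f := (fmap (WA_le rk deg l) f).
Local Notation graded l f := (fmap (WA_gr rk deg l) f).

Lemma WA_pure (X : WA) l : pure rk deg l (gr_ob l (sval X)).
Proof. by apply/(pureP hrk hdeg); exact: (svalP X l). Qed.

Lemma WA_adapted (X Y : WA) :
  exists s, adapted s (sval (sval X)) /\ adapted s (sval (sval Y)).
Proof.
have [s sX] := filtration_adapted (svalP (sval X)).
have [t tY] := filtration_adapted (svalP (sval Y)).
by exists (s ++ t); split; [apply: adapted_sub sX | apply: adapted_sub tY] => b bs;
  rewrite mem_cat bs ?orbT.
Qed.

(** Levels and graded pieces are treated together: the levelwise kernel belongs to [WA] because its
    graded pieces are kernels of morphisms between pure objects of equal slope. *)
Lemma WA_kernel (X Y : WA) (f : Mor X Y) : exists (K : WA) (k : Mor K X),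
  (forall l, is_kernel (level l f) (level l k)) /\
  (forall l, is_kernel (graded l f) (graded l k)).
Proof.
have [s [aX aY]] := WA_adapted X Y; have [pX pY] := (WA_pure X, WA_pure Y).
have [K [k kP]] := kernel_diagram (f : nat_trans (sval (sval X)) (sval (sval Y))).
pose K' : WApre L A := exist _ K (adapted_filtration (adapted_kernel aX aY kP)).
have grk l := @gr_kernel A L rk deg hrk hdeg hslope _ _ f pX pY s aX aY l K' k kP.
have K's : slope_filtration rk deg K'.
  move=> l; apply/(pureP hrk hdeg).
  by have [_ grK _] := pure_strict hrk hdeg hslope (graded l f) (pX l) (pY l) erefl;
    exact: grK (grk l).
by exists (exist _ K' K's), k.
Qed.

Lemma WA_cokernel (X Y : WA) (f : Mor X Y) : exists (Q : WA) (q : Mor Y Q),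
  (forall l, is_cokernel (level l f) (level l q)) /\
  (forall l, is_cokernel (graded l f) (graded l q)).
Proof.
have [s [aX aY]] := WA_adapted X Y; have [pX pY] := (WA_pure X, WA_pure Y).
have [Q [q qP]] := cokernel_diagram (f : nat_trans (sval (sval X)) (sval (sval Y))).
have aQ := adapted_cokernel_pure hrk hdeg hslope pX pY aX aY qP.
pose Q' : WApre L A := exist _ Q (adapted_filtration aQ).
have grq l := @gr_cokernel A L rk deg hrk hdeg hslope _ _ f pX pY s aX aY l Q' q qP.
have Q's : slope_filtration rk deg Q'.
  move=> l; apply/(pureP hrk hdeg).
  by have [_ _ grQ] := pure_strict hrk hdeg hslope (graded l f) (pX l) (pY l) erefl;
    exact: grQ (grq l).
by exists (exist _ Q' Q's), q.
Qed.

Lemma WA_is_kernel (X Y K : WA) (f : Mor X Y) (k : Mor K X) :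
  (forall l, is_kernel (level l f) (level l k)) -> is_kernel f k.
Proof. by move=> kP; do 2![apply: full_sub_kernel]; exact: nat_kernel. Qed.

Lemma WA_is_cokernel (X Y Q : WA) (f : Mor X Y) (q : Mor Y Q) :
  (forall l, is_cokernel (level l f) (level l q)) -> is_cokernel f q.
Proof. by move=> qP; do 2![apply: full_sub_cokernel]; exact: nat_cokernel. Qed.

Lemma WA_le_exact l : strongly_exact (WA_le rk deg l).
Proof.
apply: strongly_exactP => X Y f.
  by have [K [k [kP _]]] := WA_kernel f; exists K, k; split=> //; exact: WA_is_kernel.
by have [Q [q [qP _]]] := WA_cokernel f; exists Q, q; split=> //; exact: WA_is_cokernel.
Qed.

Lemma WA_gr_exact l : strongly_exact (WA_gr rk deg l).
Proof.
apply: strongly_exactP => X Y f.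
  by have [K [k [kP kG]]] := WA_kernel f; exists K, k; split=> //; exact: WA_is_kernel.
by have [Q [q [qP qG]]] := WA_cokernel f; exists Q, q; split=> //; exact: WA_is_cokernel.
Qed.

Lemma WA_incl_exact : strongly_exact (WA_incl rk deg).
Proof.
split=> [X Y K f k kP|X Y Q f q qP].
  by apply: nat_kernel => l; exact: ((WA_le_exact l).1 _ _ _ _ _ kP).
by apply: nat_cokernel => l; exact: ((WA_le_exact l).2 _ _ _ _ _ qP).
Qed.

Lemma WA_additive : is_additive WA.
Proof.
split.
  have [Z Z0 aZ] := zero_diagram L A.
  pose Z' : WApre L A := exist _ Z (adapted_filtration aZ).
  have Z's : slope_filtration rk deg Z'.
    move=> l; apply/(pureP hrk hdeg)/(pure_zero hrk hdeg).
    apply: epi_from_zero (cokernel_epi (gr_projP l Z')) _.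
    by have [aZ0 _ _] := aZ; exact: aZ0.
  by exists (exist _ Z' Z's) => Y; exact: Z0.
move=> X Y; have [s [aX aY]] := WA_adapted X Y.
have [S [i1 [i2 [p1 [p2 [bip aS]]]]]] := biproduct_diagram (sval (sval X)) (sval (sval Y)).
pose S' : WApre L A := exist _ S (adapted_filtration (aS s aX aY)).
have bip' : @is_biproduct (WApre L A) (sval X) (sval Y) S' i1 i2 p1 p2 by [].
have S's : slope_filtration rk deg S'.
  move=> l; apply/(pureP hrk hdeg).
  apply: (pure_ext hrk hdeg (biproduct_short_exact (gr_biproduct l bip'))); exact: WA_pure.
by exists (exist _ S' S's), i1, i2, p1, p2.
Qed.

Lemma WA_abelian : is_abelian WA.
Proof.
split; first exact: WA_additive.
- by move=> X Y f; have [K [k [kP _]]] := WA_kernel f; exists K, k; exact: WA_is_kernel.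
- by move=> X Y f; have [Q [q [qP _]]] := WA_cokernel f; exists Q, q; exact: WA_is_cokernel.
move=> X Y f; have [K [k [kP _]]] := WA_kernel f; have [C [c [cP _]]] := WA_cokernel f.
have [J [j [jP _]]] := WA_cokernel k; have [I [i [iP _]]] := WA_kernel c.
have [v vj] := cokernel_desc (WA_is_cokernel jP) (kernel_comp0 (WA_is_kernel kP)).
have [|u iu] := kernel_lift (t := v) (WA_is_kernel iP).
  apply: (cokernel_epi (WA_is_cokernel jP)).
  by rewrite -mcompA vj mcomp0m (cokernel_comp0 (WA_is_cokernel cP)).
exists J, j, I, i, u; split.
- by exists K, k; split; [exact: WA_is_kernel | exact: WA_is_cokernel].
- by exists C, c; split; [exact: WA_is_cokernel | exact: WA_is_kernel].
- by rewrite iu.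
(* As the coimage and the image are computed level by level, each level of [u] is the canonical
   morphism of the strict morphism at that level of [f]. *)
do 2![apply: full_sub_iso]; apply: nat_iso => l.
have [s [aX aY]] := WA_adapted X Y.
have [fs _] := level_strict hrk hdeg hslope f (WA_pure X) (WA_pure Y) aX aY l.
apply: (strict_factor_iso fs (kP l) (jP l) (cP l) (iP l)).
rewrite -vj -iu; reflexivity.
Qed.

End SlopeFiltrations.

Theorem theorem3p2p1 (A : quasiAbelianCat) (L : divOrderedGroup)
    (rk : A -> nat) (deg : A -> L)
    (hrk : rank_function rk) (hdeg : degree_function deg)
    (hslope : slope_function rk deg) :
  (forall (M N : WA rk deg) (f : Mor M N),
     strictly_compatible (fmap (WA_pre rk deg) f) /\
     strictly_cocompatible (fmap (WA_pre rk deg) f)) /\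
  is_abelian (WA rk deg) /\
  (strongly_exact (WA_incl rk deg) /\
   (forall l : L, strongly_exact (WA_le rk deg l)) /\
   (forall l : L, strongly_exact (WA_gr rk deg l))).
Proof.
split=> [M N f|].
  have [s [aM aN]] := WA_adapted M N.
  have [pM pN] := (WA_pure hrk hdeg M, WA_pure hrk hdeg N).
  split; first exact: (pure_strictly_compatible hrk hdeg hslope f pM pN aM aN).
  exact: (pure_strictly_cocompatible hrk hdeg hslope f pM pN aM aN).
split; first exact: WA_abelian.
split; first exact: WA_incl_exact.
by split=> l; [exact: WA_le_exact | exact: WA_gr_exact].
Qed.
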